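(* Let $(X,\mu,H,\Pi,\mathcal{M}_0,A)$ be as in the Abstract Setting. Assume that (i) $A$ contains a nonconstant function $f_0$, and (ii) every measure in $\mathcal{M}_0$ is absolutely continuous with respect to $\mu$. Then $\Pi$ cannot be extended to a bounded linear operator on $L^1(X,\mu)$, i.e. there is no $C<\infty$ with $\|\Pi f\|_{L^1(X,\mu)}\le C\|f\|_{L^1(X,\mu)}$ for all $f\in L^2(X,\mu)$.
   Context: Abstract Setting: $X$ is a compact connected Hausdorff space; $\mu$ is a finite regular Borel measure on $X$ of full support ($\mu(V)>0$ for every nonempty open $V$). $C(X)$ is the algebra of continuous complex functions with sup norm; $\mathcal{M}(X)$ is the space of regular complex Borel measures on $X$, identified with the dual of $C(X)$, with its weak-$*$ topology; $L^1(X,\mu)$ is viewed inside $\mathcal{M}(X)$ via $f\mapsto f\,d\mu$. $H$ is a closed linear subspace of $L^2(X,\mu)$ and $\Pi:L^2(X,\mu)\to H$ is the orthogonal projection. $\mathcal{M}_0\subseteq\mathcal{M}(X)$ is the weak-$*$ closure of $H$ (viewed in $\mathcal{M}(X)$). $A\subseteq C(X)\cap H$ is a linear subspace containing the constants and closed under pointwise multiplication (not necessarily closed in sup norm). *)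

(* Defs.v *)
From HB Require Import structures.
From mathcomp Require Import all_boot all_order all_algebra.
From mathcomp Require Import all_classical all_reals all_analysis.
From mathcomp Require Import complex.

Set Implicit Arguments.
Unset Strict Implicit.
Unset Printing Implicit Defensive.

Import Order.TTheory GRing.Theory Num.Theory.
Import numFieldNormedType.Exports.

Local Open Scope classical_set_scope.
Local Open Scope ring_scope.
Local Open Scope complex_scope.

(** The Borel sigma-algebra of a topological space [X]: the measurable type
    whose carrier is (convertible to) [X] and whose measurable sets are
    <<s open >>. *)
Notation Borel X := (g_sigma_algebraType (@open X)).

Section Setting.
Variables (R : realType) (X : ptopologicalType).
Local Notation T := (Borel X).
Local Notation C := R[i].

Definition cabs (z : C) : R :=
  Num.sqrt (complex.Re z ^+ 2 + complex.Im z ^+ 2).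

Definition ccontinuous (f : X -> C) :=
  continuous (fun x => complex.Re (f x)) /\ continuous (fun x => complex.Im (f x)).

Definition cmeasurable (f : X -> C) :=
  measurable_fun [set: T] (fun x : T => complex.Re (f x)) /\
  measurable_fun [set: T] (fun x : T => complex.Im (f x)).

Definition cint (m : {measure set T -> \bar R}) (f : X -> C) : C :=
  (fine (\int[m]_(x in [set: T]) (complex.Re (f x))%:E)) +i*
  (fine (\int[m]_(x in [set: T]) (complex.Im (f x))%:E)).

Definition L2 (mu : {measure set T -> \bar R}) (f : X -> C) :=
  cmeasurable f /\
  mu.-integrable [set: T] (fun x : T => ((cabs (f x)) ^+ 2)%:E).

Definition L1norm (mu : {measure set T -> \bar R}) (f : X -> C) : \bar R :=
  \int[mu]_(x in [set: T]) (cabs (f x))%:E.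

Definition L2norm2 (mu : {measure set T -> \bar R}) (f : X -> C) : \bar R :=
  \int[mu]_(x in [set: T]) ((cabs (f x)) ^+ 2)%:E.

Definition inner (mu : {measure set T -> \bar R}) (f g : X -> C) : C :=
  cint mu (fun x => f x * conjc (g x)).

(** H is a closed linear subspace of L^2(X,mu) (H is given as a set of
    representatives; closedness makes it saturated under a.e. equality) *)
Definition closed_L2_subspace (mu : {measure set T -> \bar R})
    (H : set (X -> C)) :=
  [/\ (forall f, H f -> L2 mu f),
      H (fun _ => 0),
      (forall f g, H f -> H g -> H (fun x => f x + g x)),
      (forall (c : C) f, H f -> H (fun x => c * f x)) &
      (forall f, L2 mu f ->
         (forall eps : R, 0 < eps -> exists2 h, H h &
            (L2norm2 mu (fun x => (f x - h x)%R) < eps%:E)%E) ->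
         H f)].

Definition is_orth_proj (mu : {measure set T -> \bar R}) (H : set (X -> C))
    (f g : X -> C) :=
  H g /\ forall h, H h -> inner mu (fun x => f x - g x) h = 0.

Definition subalgebra_in (H A : set (X -> C)) :=
  [/\ (forall f, A f -> ccontinuous f /\ H f),
      (forall c : C, A (fun _ => c)),
      (forall f g, A f -> A g -> A (fun x => f x + g x)),
      (forall (c : C) f, A f -> A (fun x => c * f x)) &
      (forall f g, A f -> A g -> A (fun x => f x * g x))].

(** mu is regular (inner regular by compacts, outer regular by opens;
    equivalently for a finite measure: compact K \subset E \subset open U with
    mu (U \ K) < eps) and of full support *)
Definition regular_measure (mu : {measure set T -> \bar R}) :=
  forall E : set T, measurable E -> forall eps : R, 0 < eps ->
    exists K U : set X, [/\ compact K, open U, K `<=` E, E `<=` U &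
      (mu (U `\` K : set T) < eps%:E)%E].

Definition full_support (mu : {measure set T -> \bar R}) :=
  forall V : set X, open V -> V !=set0 -> (0 < mu (V : set T))%E.

(** A complex Borel measure nu = nur + i nui is represented by the pair of
    (finite, countably additive, signed) charges nur, nui. *)
Definition cmeas_val (nur nui : {charge set T -> \bar R}) (B : set T) : C :=
  (fine (nur B)) +i* (fine (nui B)).

(** regularity of a complex measure: for every Borel E and eps > 0 there are
    compact K \subset E \subset open U such that every Borel B \subset U \ K
    has |nu B| < eps (equivalently, |nu|(U \ K) is small) *)
Definition cregular (nur nui : {charge set T -> \bar R}) :=
  forall E : set T, measurable E -> forall eps : R, 0 < eps ->
    exists K U : set X, [/\ compact K, open U, K `<=` E, E `<=` U &
      forall B : set T, measurable B -> B `<=` U `\` K ->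
        cabs (cmeas_val nur nui B) < eps].

(** z = \int phi dnu for the complex measure nu = nur + i nui, computed from
    Jordan decompositions nur = p1 - n1, nui = p2 - n2 into finite positive
    measures (the value does not depend on the chosen decompositions). *)
Definition cmeas_int (nur nui : {charge set T -> \bar R}) (phi : X -> C)
    (z : C) :=
  exists p1 n1 p2 n2 : {finite_measure set T -> \bar R},
    [/\ (forall E : set T, measurable E -> nur E = (p1 E - n1 E)%E),
        (forall E : set T, measurable E -> nui E = (p2 E - n2 E)%E) &
        z = (cint p1 phi - cint n1 phi) + 'i * (cint p2 phi - cint n2 phi)].

(** nu belongs to M_0, the weak-* closure (in M(X) = C(X)^* ) of
    {h dmu | h \in H}: every basic weak-* neighbourhood of nu, given by
    finitely many continuous phi_0..phi_{n-1} and eps > 0, contains some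
    h dmu with h \in H. *)
Definition in_M0 (mu : {measure set T -> \bar R}) (H : set (X -> C))
    (nur nui : {charge set T -> \bar R}) :=
  forall (n : nat) (phi : nat -> X -> C),
    (forall i, (i < n)%N -> ccontinuous (phi i)) ->
    forall eps : R, 0 < eps ->
      exists2 h, H h &
        forall i, (i < n)%N -> exists z, cmeas_int nur nui (phi i) z /\
          cabs (cint mu (fun x => phi i x * h x) - z) < eps.

Definition cabs_cont (mu : {measure set T -> \bar R})
    (nur nui : {charge set T -> \bar R}) :=
  nur `<< mu /\ nui `<< mu.

End Setting.

(* Main.v *)
(** Suppose that [Pi] is bounded for the L^1 norm, and let [x0] be any point.
    Projecting the normalized indicators of the neighbourhoods of [x0] gives a
    bounded family of L^1, whose weak-* limit along an ultrafilter is a measure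
    [nu] of [M_0] with [\int conj a dnu = conj (a x0)] for every [a] in [A], hence
    for every [a] in the uniform closure of [A]. By (ii), [nu << mu].

    The point [x0] is chosen so that evaluation at [x0] cannot come from an
    absolutely continuous measure. Say [re f0] is not constant. All but countably
    many levels [re f0 = t] are [mu]-null; on such a level take [x0] maximizing
    [im f0]. After a rotation and a scaling, [u = f0 - f0 x0] takes no value in
    the slit [(-oo, 0)], so the resolvents [(u + s)^-1], [s > 0], lie in the
    uniform closure of [A]. So do Riemann sums [b] of
    [\int_e^1 (u + s)^-1 ds = ln ((u + 1) / (u + e))], and, with
    [v = b / b x0], the functions [1 - (1 + v)^-1]. They are bounded by [2], equal
    [1/2] where [u = 0], and tend to [0] elsewhere as [e -> 0]; integrating them
    against [nu] gives [1/2 = nu (u = 0) / 2 = 0], as [mu (u = 0) = 0]. *)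
Require Import Defs.
From HB Require Import structures.
From mathcomp Require Import all_boot all_order all_algebra.
From mathcomp Require Import all_classical all_reals all_analysis.
From mathcomp Require Import measurable_realfun complex ring lra.

Import Order.TTheory GRing.Theory Num.Theory.
Import numFieldNormedType.Exports.
Local Open Scope classical_set_scope.
Local Open Scope ring_scope.

Set Implicit Arguments.
Unset Strict Implicit.
Unset Printing Implicit Defensive.

(** The conjugate in the limit identity comes from duality: the indicator minus its projection is
    orthogonal to [H], which contains [A], so the average of [a] over a neighbourhood equals the
    integral of [a] times the conjugate of the projection. The slit matters because the uniform
    closure of [A] need not be stable under conjugation, so a function without zeros need not be
    invertible in it: on the unit circle, the inverse of the coordinate is no uniform limit of
    polynomials. The slit leads from 0 outwards off the range of [u], and resolvents are continued
    along it by Neumann series. The logarithm matters because [s (u + s)^-1], though equal to 1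
    where [u = 0] and tending to 0 elsewhere, has no bound uniform in [s]: the range of [u] may come
    so close to the slit that [|u + s|] is much smaller than [s]. The logarithm has real part
    [ln (|u + 1| / |u + e|)], nonnegative whatever the shape of the range, and [1 - (1 + v)^-1] is
    bounded on the right half-plane. *)

Local Notation re := complex.Re.
Local Notation im := complex.Im.

(** * Regular measures from contents on closed sets *)

Section RegularExtension.
Context {R : realType} {X : ptopologicalType}.
Hypotheses (cX : compact [set: X]) (hX : hausdorff_space X).
Variable lam : set X -> R.
Hypothesis lam0 : lam set0 = 0.
Hypothesis lam_le : forall A B, closed A -> closed B -> A `<=` B -> lam A <= lam B.
Hypothesis lamU_le : forall A B, closed A -> closed B ->
  lam (A `|` B) <= lam A + lam B.
Hypothesis lamU : forall A B, closed A -> closed B -> A `&` B = set0 ->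
  lam (A `|` B) = lam A + lam B.

Local Open Scope ereal_scope.

(** The classical two-step extension of a content: open sets are measured from inside by closed
    sets, then arbitrary sets from outside by open sets. This regularizes [lam], which need not be
    outer regular on closed sets. *)
Definition inner_content (U : set X) : \bar R :=
  ereal_sup [set (lam K)%:E | K in [set K | closed K /\ K `<=` U]].

Definition content_outer (E : set X) : \bar R :=
  ereal_inf [set inner_content U | U in [set U | open U /\ E `<=` U]].

Let inner_content_ge0 U : 0 <= inner_content U.
Proof.
apply: ereal_sup_ubound; exists set0; last by rewrite lam0.
by split=> //; exact: closed0.
Qed.

Let le_inner_content U V : U `<=` V -> inner_content U <= inner_content V.
Proof.
move=> UV; apply: le_ereal_sup => _ [K [cK KU] <-]; exists K => //.
by split=> //; exact: subset_trans UV.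
Qed.

Let inner_content_ub K U : closed K -> K `<=` U -> (lam K)%:E <= inner_content U.
Proof. by move=> cK KU; apply: ereal_sup_ubound; exists K. Qed.

Let inner_content_le_setT U : inner_content U <= (lam setT)%:E.
Proof.
by apply: ge_ereal_sup => _ [K [cK _] <-]; rewrite lee_fin lam_le//; exact: closedT.
Qed.

Let inner_content_fin U : inner_content U \is a fin_num.
Proof.
rewrite ge0_fin_numE//; apply: le_lt_trans (inner_content_le_setT U) _.
exact: ltry.
Qed.

(** By normality the disjoint closed sets [K \ V] and [K \ U] lie in disjoint open sets [P] and [Q].
    Removing [Q] from [K] leaves a closed part of [U], removing [P] a closed part of [V]. *)
Let split_closed (K U V : set X) : closed K -> open U -> open V -> K `<=` U `|` V ->
  exists A B, [/\ closed A, closed B, A `<=` U, B `<=` V & K = A `|` B].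
Proof.
move=> cK oU oV KUV.
have /(@normal_openP R) nX := compact_normal hX cX.
have [||| P [Q [oP oQ KP KQ PQ]]] := nX (K `\` V) (K `\` U).
- by rewrite setDE; apply: closedI => //; exact: open_closedC.
- by rewrite setDE; apply: closedI => //; exact: open_closedC.
- apply/seteqP; split=> // x [[Kx nV] [_ nU]].
  by case: (KUV _ Kx).
exists (K `\` Q), (K `\` P); split.
- by rewrite setDE; apply: closedI => //; exact: open_closedC.
- by rewrite setDE; apply: closedI => //; exact: open_closedC.
- by move=> x [Kx nQ]; apply: contrapT => nU; apply: nQ; exact: KQ.
- by move=> x [Kx nP]; apply: contrapT => nV; apply: nP; exact: KP.
- apply/seteqP; split=> x; last by case=> -[].
  move=> Kx; have [Px|nPx] := pselect (P x); [left|right] => //; split=> // Qx.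
  by have : (P `&` Q) x by []; rewrite PQ.
Qed.

Let lam_le_sum (U : (set X)^nat) n K : (forall i, open (U i)) -> closed K ->
  K `<=` \bigcup_(i < n) U i -> (lam K)%:E <= \sum_(i < n) inner_content (U i).
Proof.
move=> oU; elim: n K => [|n IH] K cK KU.
  have -> : K = set0 by rewrite -subset0 => x Kx; have [] := KU x Kx.
  by rewrite lam0 big_ord0.
have [|||| A [B [cA cB AU BU KE]]] := @split_closed K (\bigcup_(i < n) U i) (U n).
- by [].
- by apply: bigcup_open.
- by [].
- move=> x /KU [i /= iln Uix]; move: iln; rewrite ltnS leq_eqVlt => /predU1P[<-|ln].
    by right.
  by left; exists i.
rewrite KE big_ord_recr/=; apply: (@le_trans _ _ (lam A + lam B)%:E).
  by rewrite lee_fin lamU_le.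
by rewrite EFinD leeD//; [exact: IH|exact: inner_content_ub].
Qed.

Let inner_content_bigcup (U : (set X)^nat) : (forall i, open (U i)) ->
  inner_content (\bigcup_i U i) <= \sum_(i <oo) inner_content (U i).
Proof.
move=> oU; apply: ge_ereal_sup => _ [K [cK KU] <-].
have cpK : compact K by apply: (subclosed_compact cK cX).
move: cpK; rewrite compact_cover => /(_ nat setT U (fun i _ => oU i) KU) [D _ KD].
pose n := (\max_(i <- finmap.enum_fset D) i.+1)%N.
apply: (@le_trans _ _ (\sum_(i < n) inner_content (U i))).
  apply: lam_le_sum => // x /KD [i /= iD Uix]; exists i => //=.
  by rewrite /n; apply: (@leq_bigmax_seq _ _ predT (fun i => i.+1) i).
rewrite -(big_mkord xpredT (fun i => inner_content (U i))).
by apply: nneseries_lim_ge => i _ _.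
Qed.

Let content_outer_open U : open U -> content_outer U = inner_content U.
Proof.
move=> oU; apply/eqP; rewrite eq_le; apply/andP; split.
  by apply: ge_ereal_inf; exists (inner_content U) => //; exists U => //; split.
by apply: le_ereal_inf_tmp => _ [V [oV UV] <-]; exact: le_inner_content.
Qed.

Let content_outer0 : content_outer set0 = 0.
Proof.
rewrite content_outer_open; last exact: open0.
apply/eqP; rewrite eq_le inner_content_ge0 andbT.
apply: ge_ereal_sup => x [K [cK]]; rewrite subset0 => -> <-.
by rewrite lam0.
Qed.

Let content_outer_ge0 A : 0 <= content_outer A.
Proof. by apply: le_ereal_inf_tmp => _ [V _ <-]. Qed.

Let le_content_outer : {homo content_outer : A B / A `<=` B >-> A <= B}.
Proof.
move=> A B AB; apply: le_ereal_inf => _ [V [oV BV] <-]; exists V => //.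
by split=> //; exact: subset_trans BV.
Qed.

Let content_outer_fin E : content_outer E \is a fin_num.
Proof.
rewrite ge0_fin_numE//; apply: le_lt_trans (ltry (lam setT)).
apply: le_trans (inner_content_le_setT setT).
rewrite -content_outer_open; last exact: openT.
exact: le_content_outer.
Qed.

Let content_outer_approx E (e : R) : (0 < e)%R ->
  exists2 U, open U /\ E `<=` U & inner_content U < content_outer E + e%:E.
Proof.
move=> e0; have := lb_ereal_inf_adherent e0 (content_outer_fin E).
by move=> [_ [U ? <-] ?]; exists U.
Qed.

Let content_outer_sigma_subadditive : sigma_subadditive content_outer.
Proof.
move=> A; apply/lee_addgt0Pr => e e0.
rewrite (le_trans _ (epsilon_trick _ _ (ltW e0)))//.
have /choice[U UA] : forall n, exists U, [/\ open U, A n `<=` U &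
    inner_content U <= content_outer (A n) + (e / (2 ^ n.+1)%:R)%:E].
  move=> n; have e2 : (0 < e / (2 ^ n.+1)%:R)%R.
    by rewrite divr_gt0// ltr0n expn_gt0.
  by have [U [oU AU] /ltW ?] := content_outer_approx (A n) e2; exists U.
apply: (@le_trans _ _ (content_outer (\bigcup_n U n))).
  apply: le_content_outer => x [n _ Anx]; exists n => //.
  by case: (UA n) => _ + _; exact.
rewrite content_outer_open; last first.
  by apply: bigcup_open => n _; case: (UA n).
apply: (le_trans (inner_content_bigcup _)); first by move=> n; case: (UA n).
by apply: lee_nneseries => // n _; case: (UA n).
Qed.

HB.instance Definition _ := isOuterMeasure.Build R X content_outer
  content_outer0 content_outer_ge0 le_content_outer
  content_outer_sigma_subadditive.

(** Replace the test set by a nearly optimal open [V]. A closed [K] inside [V & U] and a closed [L]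
    inside the open set [V \ K] are disjoint, so [lam K + lam L = lam (K | L)] is at most the
    content of [V]; take suprema over [L], then over [K]. *)
Let open_caratheodory U : open U -> content_outer.-caratheodory U.
Proof.
move=> oU; apply: le_caratheodory_measurable => E.
apply/lee_addgt0Pr => e e0.
have [V [oV EV] /ltW/(le_trans _)] := content_outer_approx E e0; apply.
apply: (@le_trans _ _ (content_outer (V `&` U) + content_outer (V `&` ~` U))).
  by apply: leeD; apply: le_content_outer; exact: setSI.
rewrite content_outer_open; last exact: openI.
rewrite -leeBrDr//; apply: ge_ereal_sup => _ [K [cK KVU] <-].
rewrite leeBrDr// addeC -leeBrDr//.
apply: (@le_trans _ _ (content_outer (V `\` K))).
  by apply: le_content_outer => x [Vx nUx]; split=> // /KVU [].
have oVK : open (V `\` K) by rewrite setDE; apply: openI => //; exact: closed_openC.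
rewrite content_outer_open//.
apply: ge_ereal_sup => _ [L [cL LVK] <-].
rewrite leeBrDr// -EFinD -lamU//; last first.
  by apply/seteqP; split=> // x [/LVK []].
apply: inner_content_ub; first exact: closedU.
by move=> x [/LVK []|/KVU []].
Qed.

Let Borel_caratheodory (E : set (Borel X)) : measurable E ->
  content_outer.-caratheodory E.
Proof.
move=> mE.
have sig : sigma_algebra setT (content_outer.-caratheodory : set (set X)).
  split.
  - exact: caratheodory_measurable_set0.
  - move=> A mA; rewrite setTD; exact: caratheodory_measurable_setC.
  - exact: caratheodory_measurable_bigcup.
exact: (smallest_sub sig open_caratheodory mE).
Qed.

(** A copy of [content_outer] on the measurable type [Borel X]: the original carries the outer
    measure structure, the copy the measure structure. *)
Definition content_measure (E : set (Borel X)) : \bar R := content_outer E.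

Let content_measure0 : content_measure set0 = 0.
Proof. exact: content_outer0. Qed.

Let content_measure_ge0 E : 0 <= content_measure E.
Proof. exact: content_outer_ge0. Qed.

Let content_measure_sigma_additive : semi_sigma_additive content_measure.
Proof.
move=> A mA tA mUA.
exact: (@caratheodory_measure_sigma_additive _ _ content_outer A
  (fun i => Borel_caratheodory (mA i)) tA (Borel_caratheodory mUA)).
Qed.

HB.instance Definition _ := isMeasure.Build _ (Borel X) R content_measure
  content_measure0 content_measure_ge0 content_measure_sigma_additive.

Let content_measure_fin : fin_num_fun content_measure.
Proof. by move=> E _; exact: content_outer_fin. Qed.

HB.instance Definition _ := @Measure_isFinite.Build _ (Borel X) R content_measure
  content_measure_fin.

Let mopen (U : set X) : open U -> measurable (U : set (Borel X)).
Proof. by move=> oU; exact: sub_sigma_algebra. Qed.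

(** On closed sets an inequality is the best possible, since [lam K] may be smaller than the content
    of every open set around [K]. Equality of the total masses is what later upgrades it to equality
    of integrals. *)
Theorem regular_extension :
  exists p : {finite_measure set (Borel X) -> \bar R},
    [/\ regular_measure p,
        (forall K : set X, closed K -> (lam K)%:E <= p K) &
        p setT = (lam setT)%:E].
Proof.
exists content_measure; split.
- move=> E mE e e0; have e2 : (0 < e / 2)%R by rewrite divr_gt0.
  (* Outer approximation of both [E] and its complement: the complement of [V] is the compact set
     inside [E], and the gap splits into two excesses below [e / 2]. *)
  have [U [oU EU] hU] := content_outer_approx E e2.
  have [V [oV EV] hV] := content_outer_approx (~` E) e2.
  have mU := mopen oU; have mV := mopen oV.
  exists (~` V), U; split => //.
  - by apply: (subclosed_compact _ cX) => //; exact: open_closedC.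
  - by move=> x nVx; apply: contrapT => nE; apply: nVx; exact: EV.
  have -> : U `\` ~` V = (U `\` E) `|` (V `\` ~` E).
    apply/seteqP; split=> x /=.
      move=> [Ux /contrapT Vx]; have [Ex|nEx] := pselect (E x); [right|left] => //.
      by split=> //; exact.
    move=> [[Ux nE]|[Vx /contrapT Ex]]; split=> //.
    - by move=> nV; apply: nV; exact: EV.
    - exact: EU.
  have cD (A W : set (Borel X)) : measurable A -> open (W : set X) -> A `<=` W ->
      inner_content W < content_outer A + (e / 2)%:E ->
      content_measure (W `\` A) < (e / 2)%:E.
    move=> mA oW AW hW; rewrite measureD//; last 2 first.
    - exact: mopen.
    - by rewrite ltey_eq content_measure_fin//; exact: mopen.
    rewrite (setIidr AW) lteBlDl; last exact: content_outer_fin.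
    change (content_outer W < content_outer A + (e / 2)%:E).
    by rewrite content_outer_open.
  have mUE : measurable (U `\` E : set (Borel X)) by exact: measurableD.
  have mVE : measurable (V `\` ~` E : set (Borel X)).
    by apply: measurableD => //; exact: measurableC.
  apply: le_lt_trans (measureU2 _ _ _) _ => //.
  rewrite [e in e%:E]splitr EFinD; apply: lteD; apply: cD => //.
  exact: measurableC.
- move=> K cK; apply: le_ereal_inf_tmp => _ [U [oU KU] <-].
  exact: inner_content_ub.
- change (content_outer setT = (lam setT)%:E).
  rewrite content_outer_open; last exact: openT.
  apply/eqP; rewrite eq_le inner_content_le_setT /= inner_content_ub//.
Qed.

End RegularExtension.

(** * Weak-* limits of bounded families of densities *)

Section RealIntegrals.
Context d (T : measurableType d) (R : realType).
Implicit Types m : {measure set T -> \bar R}.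

Lemma bounded_by (f : T -> R) (B : R) :
  (forall x, `|f x| <= B) -> [bounded f x | x in [set: T]].
Proof.
move=> fB; exists B; split; first exact: num_real.
by move=> y By x _; apply: le_trans (fB x) (ltW By).
Qed.

Lemma bounded_integrable (m : {finite_measure set T -> \bar R}) (f : T -> R) (B : R) :
  measurable_fun setT f -> (forall x, `|f x| <= B) ->
  m.-integrable setT (EFin \o f).
Proof.
move=> mf fB; apply: measurable_bounded_integrable => //.
- by rewrite -ge0_fin_numE// fin_num_measure.
- exact: bounded_by fB.
Qed.

Lemma integrableM_bounded m (f g : T -> R) (B : R) :
  measurable_fun setT f -> (forall x, `|f x| <= B) ->
  m.-integrable setT (EFin \o g) -> m.-integrable setT (EFin \o (f \* g)).
Proof.
by move=> mf fB ig; exact: (integrableMr measurableT mf (bounded_by fB) ig).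
Qed.

Lemma le_RintegralT m (f g : T -> R) : m.-integrable setT (EFin \o f) ->
  m.-integrable setT (EFin \o g) -> (forall x, f x <= g x) ->
  \int[m]_x f x <= \int[m]_x g x.
Proof. by move=> fi gi fg; apply: le_Rintegral => // x _; exact: fg. Qed.

Lemma Rintegral_sum m n (f : nat -> T -> R) :
  (forall k, m.-integrable setT (EFin \o f k)) ->
  \int[m]_x (\sum_(k < n) f k x) = \sum_(k < n) \int[m]_x f k x /\
  m.-integrable setT (fun x => (\sum_(k < n) f k x)%:E).
Proof.
move=> fi; elim: n => [|n [IH1 IH2]].
  split; last by under eq_fun do rewrite big_ord0; exact: integrable0.
  under eq_Rintegral do rewrite big_ord0.
  by rewrite big_ord0 Rintegral_cst// mul0r.
split.
  under eq_Rintegral do rewrite big_ord_recr/=.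
  by rewrite RintegralD// IH1 big_ord_recr.
under eq_fun do rewrite big_ord_recr/= EFinD.
exact: (integrableD measurableT IH2 (fi n)).
Qed.

End RealIntegrals.

Lemma cvg_le_lim {I : Type} {F : set_system I} {FF : ProperFilter F}
  (R : realType) (f g : I -> R) (a b : R) :
  f @ F --> a -> g @ F --> b -> (forall i, f i <= g i) -> a <= b.
Proof.
move=> fa gb fg; rewrite -subr_ge0.
apply: (@closed_cvg _ _ F _ (fun i => g i - f i) (fun z => 0 <= z)).
- exact: closed_ge.
- by apply: nearW => i; rewrite subr_ge0.
- exact: cvgB.
Qed.

Lemma fmap_ultra (I J : Type) (U : set_system I) (h : I -> J) :
  UltraFilter U -> UltraFilter (h @ U).
Proof.
move=> UU; split; first exact: fmap_proper_filter.
move=> G GG UG; apply/seteqP; split=> // A GA.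
case: (in_ultra_setVsetC (h @^-1` A) UU) => // nA.
have GnA : G (~` A) by apply: UG.
have : G (A `&` ~` A) by exact: filterI.
by rewrite setICr => /filter_not_empty.
Qed.

(** An ultrafilter on a compact interval converges. Ultrafilters stand in for subsequences because
    C(X) may fail to be separable. *)
Lemma ultra_bounded_cvg (I : Type) (U : set_system I) (R : realType)
  (h : I -> R) (M : R) :
  UltraFilter U -> (forall i, `|h i| <= M) -> exists l : R, h @ U --> l.
Proof.
move=> UU hM; have := @segment_compact R (- M) M.
rewrite compact_ultra => /(_ (h @ U) (fmap_ultra h UU)).
case; last by move=> l [_]; exists l.
by apply: nearW => i /=; rewrite in_itv/= -ler_norml.
Qed.

Section BorelFacts.
Context {R : realType} {X : ptopologicalType}.

Lemma open_Borel (U : set X) : open U -> measurable (U : set (Borel X)).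
Proof. by move=> oU; exact: sub_sigma_algebra. Qed.

Lemma closed_Borel (K : set X) : closed K -> measurable (K : set (Borel X)).
Proof.
move=> cK; rewrite -[K]setCK; apply: measurableC.
by apply: open_Borel; exact: closed_openC.
Qed.

Lemma continuous_Borel (f : X -> R) : continuous f ->
  measurable_fun [set: Borel X] (f : Borel X -> R).
Proof.
move=> cf; apply: (measurability _ (RGenOpens.measurableE R)).
move=> _ [_ [a [b ->] <-]]; rewrite setTI; apply: open_Borel.
by apply: open_comp => [x _|]; [exact: cf|exact: interval_open].
Qed.

Lemma compact_continuous_bounded (f : X -> R) : compact [set: X] ->
  continuous f -> exists2 B, 0 < B & forall x, `|f x| <= B.
Proof.
move=> cX cf.
have cnf : {within [set: X], continuous (fun x => `|f x|)}.
  by apply: continuous_subspaceT => x; apply: cvg_norm; exact: cf.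
have [c _ hc] := compact_EVT_max (ex_intro _ point I) cX cnf.
exists (`|f c| + 1); first by rewrite ltr_pwDr.
by move=> x; rewrite (le_trans (hc x _)) ?in_setT// lerDl.
Qed.

End BorelFacts.

(** The sum counts the integers from 1 to [n] below [y], so it is the minimum of [n] and the integer
    part of [y]. At [y = n * phi x] it approximates [phi] within [1 / n] by indicators of closed
    level sets. *)
Lemma layer_cake_bounds (R : realType) (n : nat) (y : R) : 0 <= y ->
  let s := \sum_(k < n) ((k.+1%:R <= y)%R : nat)%:R : R in
  [/\ s <= y, s <= n%:R & Num.min n%:R (y - 1) <= s].
Proof.
move=> y0; elim: n => [|n] /=.
  by rewrite big_ord0; split=> //; rewrite ge_min lexx.
rewrite big_ord_recr/=; set s := \sum_(_ < _) _ => -[s1 s2 s3].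
have nE : n.+1%:R = n%:R + 1 :> R by rewrite -natr1.
case: (leP n.+1%:R y) => /= ny; move: s3; rewrite !ge_min ?mulr1n ?mulr0n ?addr0 ?nE;
  rewrite nE in ny => s3.
  split; [lra|lra|].
  by case/orP: s3 => s3; apply/orP; left; lra.
split; [by []|lra|].
by case/orP: s3 => s3; apply/orP; right; lra.
Qed.

Section WeakStarLimit.
Context {R : realType} {X : ptopologicalType}.
Hypotheses (cX : compact [set: X]) (hX : hausdorff_space X).
Variable mu : {finite_measure set (Borel X) -> \bar R}.
Context {I : Type} {U : set_system I}.
Hypothesis UU : UltraFilter U.
Variables (g : I -> Borel X -> R) (M : R).
Hypothesis gm : forall i, measurable_fun setT (g i).
Hypothesis g0 : forall i x, 0 <= g i x.
Hypothesis gM : forall i, (\int[mu]_x (g i x)%:E <= M%:E)%E.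

Let g_int i : mu.-integrable setT (EFin \o g i).
Proof.
apply/integrableP; split; first exact/measurable_EFinP.
apply: le_lt_trans (ltry M); apply: le_trans (gM i).
by under eq_integral do rewrite /= ger0_norm//.
Qed.

Let gM' i : \int[mu]_x g i x <= M.
Proof.
rewrite -lee_fin fineK ?gM//.
have := integrable_fin_num measurableT (g_int i); exact.
Qed.

Let mass i (A : set X) : R := \int[mu]_(x in (A : set (Borel X))) g i x.

Let mass_indic i (A : set (Borel X)) : measurable A ->
  mass i A = \int[mu]_x (\1_A x * g i x).
Proof.
move=> mA; rewrite /mass Rintegral_mkcond; apply: eq_Rintegral => x _.
rewrite patchE indicE; case: ifPn => _; by rewrite ?mul1r ?mul0r.
Qed.

Let indicM_int i (A : set (Borel X)) : measurable A ->
  mu.-integrable setT (EFin \o (\1_A \* g i)).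
Proof.
move=> mA; apply: (@integrableM_bounded _ _ _ _ _ _ 1) => // x.
by rewrite indicE; case: (_ \in _); rewrite ?normr1 ?normr0.
Qed.

Let le_mass i (A B : set (Borel X)) : measurable A -> measurable B ->
  A `<=` B -> mass i A <= mass i B.
Proof.
move=> mA mB AB; rewrite !mass_indic//; apply: le_RintegralT; try exact: indicM_int.
move=> x; apply: ler_wpM2r => //; rewrite !indicE.
by have [/set_mem/AB/mem_set ->|] := boolP (x \in A) => //; rewrite ler_nat.
Qed.

Let massU i (A B : set (Borel X)) : measurable A -> measurable B ->
  A `&` B = set0 -> mass i (A `|` B) = mass i A + mass i B.
Proof.
move=> mA mB AB; rewrite /mass Rintegral_setU//; last exact/eqP.
apply: (integrableS (E := setT)) => //; exact: measurableU.
Qed.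

Let mass_ge0 i A : 0 <= mass i A.
Proof. by apply: Rintegral_ge0. Qed.

Let mass_norm i (A : set (Borel X)) : measurable A -> `|mass i A| <= M.
Proof.
move=> mA; rewrite ger0_norm//; apply: le_trans (gM' i).
exact: le_mass.
Qed.

(** This limit is finitely additive on Borel sets but may fail to be countably additive, since mass
    can escape to a boundary. Only its values on closed sets are kept and extended. *)
Let lam (A : set X) : R := lim ((mass ^~ A) @ U).

Let lamP (A : set (Borel X)) : measurable A -> (mass ^~ A) @ U --> lam A.
Proof.
move=> mA; apply/cvg_ex.
exact: (ultra_bounded_cvg UU (fun i => mass_norm i mA)).
Qed.

Let le_lam (A B : set (Borel X)) : measurable A -> measurable B ->
  A `<=` B -> lam A <= lam B.
Proof.
move=> mA mB AB; apply: (cvg_le_lim (lamP mA) (lamP mB)) => i.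
exact: le_mass.
Qed.

Let lam_setU (A B : set (Borel X)) : measurable A -> measurable B ->
  A `&` B = set0 -> lam (A `|` B) = lam A + lam B.
Proof.
move=> mA mB AB; apply: (cvg_unique _ (lamP (measurableU _ _ mA mB))).
  exact: Rhausdorff.
have -> : mass^~ (A `|` B) = (fun i => mass i A + mass i B).
  by apply/funext => i /=; rewrite massU.
by apply: cvgD; exact: lamP.
Qed.

Let lam_extension :
  exists p : {finite_measure set (Borel X) -> \bar R},
    [/\ regular_measure p,
        (forall K : set X, closed K -> (lam K)%:E <= p K)%E &
        p setT = (lam setT)%:E].
Proof.
apply: (regular_extension cX hX).
- have -> : lam set0 = lim ((fun=> 0 : R) @ U).
    congr (lim (_ @ U)); apply/funext => i; exact: Rintegral_set0.
  exact: lim_cst.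
- by move=> A B /closed_Borel mA /closed_Borel mB; exact: le_lam.
- move=> A B /closed_Borel mA /closed_Borel mB.
  have mBA : measurable (B `\` A : set (Borel X)) by exact: measurableD.
  have -> : A `|` B = A `|` (B `\` A).
    apply/seteqP; split=> x [Ax|]; [by left| |by left|by case=> Bx _; right].
    by have [Ax|nAx] := pselect (A x); [left|right].
  rewrite lam_setU//; last by apply/seteqP; split=> // x [Ax []].
  by rewrite lerD2l; apply: le_lam => //; exact: subDsetl.
- by move=> A B /closed_Borel mA /closed_Borel mB; exact: lam_setU.
Qed.

Let phi_int (phi : X -> R) i : continuous phi ->
  mu.-integrable setT (EFin \o ((phi : Borel X -> R) \* g i)).
Proof.
move=> cphi; have [B _ phiB] := compact_continuous_bounded cX cphi.
exact: (integrableM_bounded (continuous_Borel cphi) phiB (g_int i)).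
Qed.

Let phi_cvg (phi : X -> R) : continuous phi ->
  exists l : R, (fun i => \int[mu]_x (phi x * g i x)) @ U --> l.
Proof.
move=> cphi; have [B B0 phiB] := compact_continuous_bounded cX cphi.
apply: (@ultra_bounded_cvg _ _ _ _ (B * M)) => // i.
apply: (le_trans (le_normr_Rintegral measurableT (phi_int i cphi))).
apply: (@le_trans _ _ (\int[mu]_x (B * g i x))).
  apply: le_RintegralT.
  - exact: integrable_norm (phi_int i cphi).
  - exact: (integrableZl measurableT B (g_int i)).
  - by move=> x; rewrite normrM (ger0_norm (g0 _ _)) ler_wpM2r.
by rewrite RintegralZl// ler_pM2l.
Qed.

Section Comparison.
Variable p : {finite_measure set (Borel X) -> \bar R}.
Hypothesis lam_p : forall K : set X, closed K -> ((lam K)%:E <= p K)%E.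
Hypothesis pT : p setT = (lam setT)%:E.

(** Layer cake: the same sum of indicators of the closed sets [K k] bounds [phi] from above, up to
    [1 / (n + 1)], and from below. The upper bound is integrated against [g i] and its limit
    involves [lam (K k)]; the lower bound is integrated against [p]; [lam (K k) <= p (K k)] links
    the two. *)
Let cvg_le_unit (phi : X -> R) l : continuous phi ->
  (forall x, 0 <= phi x <= 1) ->
  (fun i => \int[mu]_x (phi x * g i x)) @ U --> l -> l <= \int[p]_x phi x.
Proof.
move=> cphi phi01 phil.
suff H n : l <= n.+1%:R^-1 * lam setT + \int[p]_x phi x.
  have c : (fun n => n.+1%:R^-1 * lam setT + \int[p]_x phi x) @ \oo -->
      0 * lam setT + \int[p]_x phi x.
    apply: cvgD; last exact: cvg_cst.
    by apply: cvgM; [exact: cvg_harmonic|exact: cvg_cst].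
  rewrite mul0r add0r in c.
  by apply: (cvg_le_lim (cvg_cst l) c) => n; exact: H.
pose K k := [set x | k.+1%:R <= n.+1%:R * phi x].
have cK k : closed (K k).
  apply: (@closed_comp _ _ (fun x => n.+1%:R * phi x) [set y | k.+1%:R <= y]).
    by move=> x _; apply: cvgM; [exact: cvg_cst|exact: cphi].
  exact: closed_ge.
have mK k : measurable (K k : set (Borel X)) by exact: closed_Borel.
have n0 : 0 < n.+1%:R :> R by rewrite ltr0n.
have KE x : \sum_(k < n.+1) ((k.+1%:R <= n.+1%:R * phi x)%R : nat)%:R =
    \sum_(k < n.+1) \1_(K k) x :> R.
  by apply: eq_bigr => k _; rewrite indicE mem_setE.
have phi0 x : 0 <= n.+1%:R * phi x by case/andP: (phi01 x) => ? _; rewrite mulr_ge0.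
have up x : phi x <= n.+1%:R^-1 * (1 + \sum_(k < n.+1) \1_(K k) x).
  have [_ _] := layer_cake_bounds n.+1 (phi0 x); rewrite KE => h.
  rewrite ler_pdivlMl//.
  move: h; rewrite ge_min; case/orP => h; last lra.
  apply: (@le_trans _ _ n.+1%:R); last lra.
  by rewrite ger_pMr//; case/andP: (phi01 x).
have lo x : n.+1%:R^-1 * \sum_(k < n.+1) \1_(K k) x <= phi x.
  have [h _ _] := layer_cake_bounds n.+1 (phi0 x); rewrite KE in h.
  by rewrite ler_pdivrMl.
have ub i : \int[mu]_x (phi x * g i x) <=
    n.+1%:R^-1 * (mass i setT + \sum_(k < n.+1) mass i (K k)).
  have [s1 s2] := Rintegral_sum n.+1 (fun k => indicM_int i (mK k)).
  rewrite /= in s1 s2.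
  have -> : \sum_(k < n.+1) mass i (K k) =
      \int[mu]_x (\sum_(k < n.+1) (\1_(K k) x * g i x)).
    by rewrite s1; apply: eq_bigr => k _; rewrite mass_indic.
  rewrite /mass -RintegralD// -RintegralZl//; last exact: (integrableD measurableT (g_int i) s2).
  apply: le_RintegralT; first exact: phi_int.
    apply: (integrableZl measurableT (n.+1%:R^-1) (integrableD measurableT (g_int i) s2)).
  move=> x; rewrite -mulr_suml -[X in _ * (X + _)]mul1r -mulrDl mulrA.
  by apply: ler_wpM2r.
have lim_ub : (fun i => n.+1%:R^-1 * (mass i setT + \sum_(k < n.+1) mass i (K k)))
    @ U --> n.+1%:R^-1 * (lam setT + \sum_(k < n.+1) lam (K k)).
  apply: cvgM; first exact: cvg_cst.
  apply: cvgD; first exact: lamP.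
  elim: n.+1 => [|q IH].
    rewrite big_ord0; under eq_fun do rewrite big_ord0; exact: cvg_cst.
  rewrite big_ord_recr/=; under eq_fun do rewrite big_ord_recr/=.
  by apply: cvgD => //; exact: lamP.
apply: (le_trans (cvg_le_lim phil lim_ub ub)).
rewrite mulrDr lerD2l.
have iK k : p.-integrable setT (EFin \o (\1_(K k) : Borel X -> R)).
  apply: (@bounded_integrable _ _ _ _ _ 1) => // x.
  by rewrite indicE; case: (_ \in _); rewrite ?normr1 ?normr0.
have [s1 s2] := Rintegral_sum n.+1 iK.
apply: (@le_trans _ _ (\int[p]_x (n.+1%:R^-1 * \sum_(k < n.+1) \1_(K k) x))).
  rewrite RintegralZl// s1 ler_pM2l ?invr_gt0//.
  apply: ler_sum => k _; rewrite -lee_fin.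
  apply: le_trans (lam_p (cK k)) _.
  rewrite fineK; first by rewrite integral_indic// setIT.
  exact: (integrable_fin_num measurableT (iK k)).
apply: le_RintegralT => //.
- exact: (integrableZl measurableT _ s2).
- apply: (@bounded_integrable _ _ _ _ _ 1); first exact: continuous_Borel.
  by move=> x; case/andP: (phi01 x) => ? ?; rewrite ger0_norm.
Qed.

Let cont_int (phi : X -> R) : continuous phi ->
  p.-integrable setT (EFin \o (phi : Borel X -> R)).
Proof.
move=> cphi; have [B _ phiB] := compact_continuous_bounded cX cphi.
exact: (bounded_integrable p (continuous_Borel cphi) phiB).
Qed.

Let cvg_le_int (phi : X -> R) l : continuous phi ->
  (fun i => \int[mu]_x (phi x * g i x)) @ U --> l -> l <= \int[p]_x phi x.
Proof.
move=> cphi phil; have [B B0 phiB] := compact_continuous_bounded cX cphi.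
(* The range of [psi] lies in [0, 1]. The added constant contributes [B * lam setT] on both sides,
   as [p] has total mass [lam setT], and cancels. *)
pose psi x := (2 * B)^-1 * (phi x + B).
have B2 : 0 < 2 * B by rewrite mulr_gt0.
have cpsi : continuous psi.
  move=> x; apply: cvgM; first exact: cvg_cst.
  by apply: cvgD; [exact: cphi|exact: cvg_cst].
have psi01 x : 0 <= psi x <= 1.
  have := phiB x; rewrite ler_norml => /andP[h1 h2]; apply/andP; split.
    by apply: mulr_ge0; [rewrite invr_ge0; exact: ltW|lra].
  by rewrite /psi ler_pdivrMl//; lra.
have psil : (fun i => \int[mu]_x (psi x * g i x)) @ U -->
    (2 * B)^-1 * (l + B * lam setT).
  have -> : (fun i => \int[mu]_x (psi x * g i x)) =
      (fun i => (2 * B)^-1 * (\int[mu]_x (phi x * g i x) + B * mass i setT)).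
    apply/funext => i; have iB := integrableZl measurableT B (g_int i).
    have iphi := phi_int i cphi.
    rewrite /mass -RintegralZl// -RintegralD// -RintegralZl//; last first.
      exact: (integrableD measurableT iphi iB).
    by apply: eq_Rintegral => x _; rewrite /psi; ring.
  apply: cvgM; first exact: cvg_cst.
  apply: cvgD => //; apply: cvgM; first exact: cvg_cst.
  exact: lamP.
have := cvg_le_unit cpsi psi01 psil.
have -> : \int[p]_x psi x = (2 * B)^-1 * (\int[p]_x phi x + B * lam setT).
  have iB : p.-integrable setT (EFin \o (fun=> B)).
    exact: finite_measure_integrable_cst.
  rewrite /psi RintegralZl//; last exact: (integrableD measurableT (cont_int cphi) iB).
  rewrite RintegralD//; last exact: cont_int.
  by rewrite Rintegral_cst//= pT.
by rewrite ler_pM2l ?invr_gt0// lerD2r.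
Qed.

(** The domination of [lam] by [p] gives one inequality; its instance at [- phi] gives the other. *)
Lemma dominating_measure_cvg (phi : X -> R) : continuous phi ->
  (fun i => \int[mu]_x (phi x * g i x)) @ U --> \int[p]_x phi x.
Proof.
move=> cphi; have [l phil] := phi_cvg cphi.
suff -> : \int[p]_x phi x = l by [].
apply/eqP; rewrite eq_le (cvg_le_int cphi phil) andbT.
have cNphi : continuous (fun x => - phi x) by move=> x; apply: cvgN; exact: cphi.
have Nphil : (fun i => \int[mu]_x (- phi x * g i x)) @ U --> - l.
  have -> : (fun i => \int[mu]_x (- phi x * g i x)) =
      (fun i => - \int[mu]_x (phi x * g i x)).
    apply/funext => i; rewrite -mulN1r -RintegralZl//; last exact: phi_int.
    by apply: eq_Rintegral => x _; ring.
  exact: cvgN.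
have := cvg_le_int cNphi Nphil.
have -> : \int[p]_x (- phi x) = - \int[p]_x phi x.
  rewrite -mulN1r -RintegralZl//; last exact: cont_int.
  by apply: eq_Rintegral => x _; ring.
by rewrite lerN2.
Qed.

End Comparison.

Theorem weak_star_limit :
  exists p : {finite_measure set (Borel X) -> \bar R},
    regular_measure p /\
    forall phi : X -> R, continuous phi ->
      (fun i => \int[mu]_x (phi x * g i x)) @ U --> \int[p]_x phi x.
Proof.
have [p [rp lp pT]] := lam_extension.
by exists p; split=> //; exact: dominating_measure_cvg.
Qed.

End WeakStarLimit.

(** * Orthogonal projections in L^2 *)

(** The intervals of centre [u n] and radius [2 * c / 2 ^+ n] are nested, because consecutive radii
    differ by [c / 2 ^+ n]; the supremum of the left endpoints lies in all of them. *)
Lemma geometric_steps_limit (R : realType) (u : nat -> R) (c : R) :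
  (forall n, `|u n.+1 - u n| <= c / 2 ^+ n) ->
  exists l, forall n, `|l - u n| <= 2 * c / 2 ^+ n.
Proof.
move=> uc; pose a n := u n - 2 * c / 2 ^+ n; pose b n := u n + 2 * c / 2 ^+ n.
have halve n : 2 * c / 2 ^+ n.+1 = c / 2 ^+ n.
  by rewrite exprS invfM mulrACA divff ?mul1r.
have aS n : a n <= a n.+1.
  have := uc n; rewrite ler_norml => /andP[h _].
  by rewrite /a halve -mulrA mulr_natl mulr2n; lra.
have bS n : b n.+1 <= b n.
  have := uc n; rewrite ler_norml => /andP[_ h].
  by rewrite /b halve -mulrA mulr_natl mulr2n; lra.
have c0 : 0 <= c.
  by have := le_trans (normr_ge0 _) (uc 0); rewrite expr0 divr1.
have ab n : a n <= b n.
  have : 0 <= 2 * c / 2 ^+ n by rewrite divr_ge0 ?mulr_ge0 ?exprn_ge0.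
  by rewrite /a /b; lra.
have amono : {homo a : m n / (m <= n)%N >-> m <= n} by exact/nondecreasing_seqP.
have bmono : {homo b : m n / (m <= n)%N >-> n <= m} by exact/nonincreasing_seqP.
have abmn m n : a m <= b n.
  apply: (le_trans (amono _ _ (leq_maxl m n))).
  by apply: (le_trans (ab _)); apply: bmono; exact: leq_maxr.
have supa : has_sup (range a).
  by split; [exists (a 0), 0|exists (b 0) => _ [m _ <-]].
exists (sup (range a)) => n; rewrite ler_norml.
have la : a n <= sup (range a) by apply: sup_upper_bound => //; exists n.
have lb : sup (range a) <= b n.
  by apply: sup_le_ub; [case: supa|move=> _ [m _ <-]].
by move: la lb; rewrite /a /b => la lb; apply/andP; split; lra.
Qed.

Lemma le_of_geometric_gap (R : realType) (a b c : R) :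
  (forall n, a <= b + c / 2 ^+ n) -> a <= b.
Proof.
move=> h.
have q : (fun n => b + c / 2 ^+ n) @ \oo --> b + c * 0.
  apply: cvgD; first exact: cvg_cst.
  apply: cvgM; first exact: cvg_cst.
  under eq_fun do rewrite -exprVn.
  by apply: cvg_expr; rewrite ger0_norm ?invr_ge0// invf_lt1// ltr1n.
rewrite mulr0 addr0 in q.
exact: (cvg_le_lim (cvg_cst a) q).
Qed.

Section L2Limit.
Context d (T : measurableType d) (R : realType).
Variable mu : {measure set T -> \bar R}.

(** A quantitative Riesz-Fischer argument. With weights [4 ^+ n] the squared steps still have a sum
    [F] of integral at most [2 * C]. Where [F] is finite, the n-th step is at most
    [sqrt F / 2 ^+ n], so the limit is within [2 * sqrt F / 2 ^+ n] of [h n], and squaring and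
    integrating gives [8 * C / 4 ^+ n]. *)
Lemma L2_fast_limit (h : nat -> T -> R) (C : R) :
  (forall n, measurable_fun setT (h n)) ->
  (forall n, (\int[mu]_x ((h n.+1 x - h n x) ^+ 2)%:E <= (C / 16 ^+ n)%:E)%E) ->
  exists2 g : T -> R, measurable_fun setT g &
    forall n, (\int[mu]_x ((g x - h n x) ^+ 2)%:E <= (8 * C / 4 ^+ n)%:E)%E.
Proof.
move=> mh hC.
have C0 : 0 <= C.
  rewrite -lee_fin; have := hC 0; rewrite expr0 divr1; apply: le_trans.
  by apply: integral_ge0 => x _; rewrite lee_fin sqr_ge0.
pose D n x := (4 ^+ n * (h n.+1 x - h n x) ^+ 2)%:E.
have D0 n x : (0 <= D n x)%E by rewrite lee_fin; apply: mulr_ge0; [exact: exprn_ge0|exact: sqr_ge0].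
have mDR n : measurable_fun setT (fun x => (h n.+1 x - h n x) ^+ 2).
  by apply: measurable_funX; exact: measurable_funB.
have mD n : measurable_fun setT (D n).
  by apply/measurable_EFinP; apply: measurable_funM.
pose F x : \bar R := (\sum_(0 <= n <oo) D n x)%E.
have F0 x : (0 <= F x)%E by apply: nneseries_ge0 => n _ _; exact: D0.
have mF : measurable_fun setT F.
  by apply: (@ge0_emeasurable_sum _ _ _ _ D xpredT) => [n x _ _|n _]; [exact: D0|exact: mD].
have intF : (\int[mu]_x F x <= (2 * C)%:E)%E.
  rewrite /F integral_nneseries//.
  apply: le_trans (epsilon_trick0 xpredT _); last by rewrite mulr_ge0.
  apply: lee_nneseries => [n _ _|n _]; first by apply: integral_ge0.
  rewrite /D; under eq_integral do rewrite EFinM.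
  have msq : measurable_fun setT (fun x => ((h n.+1 x - h n x) ^+ 2)%:E).
    by apply/measurable_EFinP; exact: mDR.
  have sq0 x : [set: T] x -> (0 <= ((h n.+1 x - h n x) ^+ 2)%:E)%E.
    by move=> _; rewrite lee_fin sqr_ge0.
  have k0 : (0 <= (4 ^+ n)%:E :> \bar R)%E by rewrite lee_fin exprn_ge0.
  rewrite (ge0_integralZl mu measurableT msq sq0 k0).
  apply: (@le_trans _ _ ((4 ^+ n)%:E * (C / 16 ^+ n)%:E)%E).
    by apply: lee_pmul => //; apply: integral_ge0.
  rewrite -EFinM lee_fin.
  have -> : 4 ^+ n * (C / 16 ^+ n) = C / 4 ^+ n.
    have -> : 16 = 4 * 4 :> R by ring.
    by rewrite exprMn; field; rewrite expf_neq0.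
  have -> : 2 * C / (2 ^ n.+1)%:R = C / 2 ^+ n.
    by rewrite natrX exprS; field; rewrite expf_neq0.
  rewrite ler_wpM2l// lef_pV2 ?posrE ?exprn_gt0// lerXn2r ?nnegrE//.
  by rewrite ler_nat.
have iF : mu.-integrable setT F.
  apply/integrableP; split => //; apply: le_lt_trans (ltry (2 * C)).
  by under eq_integral do rewrite gee0_abs//.
(* Off [G], a null set, the sequence is replaced by 0, so that it converges at every point and its
   limit is measurable. *)
pose G := [set x | F x \is a fin_num].
have mG : measurable G.
  have -> : G = setT `&` [set x | F x < +oo]%E.
    by apply/seteqP; split=> x /=; rewrite /G /= ge0_fin_numE// => -[].
  exact: emeasurable_fun_infty_o.
have step x : exists l, forall n, `|l - \1_G x * h n x| <= 2 * Num.sqrt (fine (F x)) / 2 ^+ n.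
  apply: geometric_steps_limit => n; rewrite -mulrBr indicE.
  have [/set_mem Gx|_] := boolP (x \in G); last first.
    by rewrite mul0r normr0 divr_ge0 ?sqrtr_ge0 ?exprn_ge0.
  rewrite mul1r ler_pdivlMr ?exprn_gt0//.
  rewrite -[`|_|]sqrtr_sqr -[2 ^+ n]ger0_norm ?exprn_ge0// -[`|2 ^+ n|]sqrtr_sqr.
  rewrite -sqrtrM ?sqr_ge0// ler_sqrt; last by rewrite fine_ge0.
  rewrite -lee_fin fineK// -exprM mulnC exprM mulrC.
  have -> : 2 ^+ 2 = 4 :> R by ring.
  apply: le_trans (nneseries_lim_ge n.+1 (fun m _ _ => D0 m x)).
  rewrite big_nat_recr//=; apply: leeDr.
  by rewrite big_nat; apply: sume_ge0 => i _.
have [g gl] := choice step.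
have mg : measurable_fun setT g.
  apply/measurable_EFinP.
  apply: (@emeasurable_fun_cvg _ _ _ _ (fun n x => (\1_G x * h n x)%:E)).
    by move=> n; apply/measurable_EFinP; apply: measurable_funM.
  move=> x _; apply: cvg_EFin; first by apply: nearW => n.
  rewrite /comp /=.
  have c0 : (fun n => 2 * Num.sqrt (fine (F x)) / 2 ^+ n) @ \oo --> (0 : R).
    rewrite -[X in _ --> X](mulr0 (2 * Num.sqrt (fine (F x)))).
    apply: cvgM; first exact: cvg_cst.
    under eq_fun do rewrite -exprVn.
    by apply: cvg_expr; rewrite ger0_norm ?invr_ge0// invf_lt1// ltr1n.
  apply/cvgrPdist_le => e e0; move/cvgrPdist_le: c0 => /(_ _ e0).
  apply: filterS => n; rewrite sub0r normrN => /(le_trans (ler_norm _)).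
  by apply: le_trans.
exists g => // n.
have q0 : (0 <= (4 / 4 ^+ n)%:E :> \bar R)%E by rewrite lee_fin divr_ge0// exprn_ge0.
have mgh : measurable_fun setT (fun x => ((g x - h n x) ^+ 2)%:E).
  by apply/measurable_EFinP; apply: measurable_funX; exact: measurable_funB.
apply: (@le_trans _ _ (\int[mu]_x ((4 / 4 ^+ n)%:E * F x))%E).
  apply: ae_ge0_le_integral => //.

  - by move=> x _; rewrite lee_fin sqr_ge0.
  - by move=> x _; apply: mule_ge0; [exact: q0|exact: F0].
  - exact: measurable_funeM.
  have := integrable_ae measurableT iF; apply: filterS => x /(_ I) Fx _.
  have := gl x n; rewrite indicE mem_set// mul1r => gx.
  rewrite -(fineK Fx) -EFinM lee_fin -real_normK ?num_real//.
  have -> : 4 / 4 ^+ n * fine (F x) = (2 * Num.sqrt (fine (F x)) / 2 ^+ n) ^+ 2.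
    rewrite !exprMn sqr_sqrtr ?fine_ge0// exprVn -exprM mulnC exprM.
    have -> : 2 ^+ 2 = 4 :> R by ring.
    by rewrite mulrAC.
  by rewrite lerXn2r ?nnegrE// divr_ge0 ?mulr_ge0 ?sqrtr_ge0 ?exprn_ge0.
rewrite ge0_integralZl//.
have -> : 8 * C / 4 ^+ n = 4 / 4 ^+ n * (2 * C) by ring.
rewrite [leRHS]EFinM; apply: lee_pmul => //.
exact: integral_ge0.
Qed.

End L2Limit.


Section ComplexParts.
Context {R : realType}.
Implicit Types z w : R[i].

Lemma complex_eqP z w : re z = re w -> im z = im w -> z = w.
Proof. by case: z => a b; case: w => c e /= -> ->. Qed.

Lemma ReD z w : re (z + w) = re z + re w. Proof. by case: z; case: w. Qed.
Lemma ImD z w : im (z + w) = im z + im w. Proof. by case: z; case: w. Qed.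
Lemma ReN z : re (- z) = - re z. Proof. by case: z. Qed.
Lemma ImN z : im (- z) = - im z. Proof. by case: z. Qed.
Lemma ReM z w : re (z * w) = re z * re w - im z * im w.
Proof. by case: z; case: w. Qed.
Lemma ImM z w : im (z * w) = re z * im w + im z * re w.
Proof. by case: z; case: w. Qed.
Lemma ReJ z : re (conjc z) = re z. Proof. by case: z. Qed.
Lemma ImJ z : im (conjc z) = - im z. Proof. by case: z. Qed.

Lemma Re1 : re (1 : R[i]) = 1. Proof. by []. Qed.
Lemma Im1 : im (1 : R[i]) = 0. Proof. by []. Qed.
Lemma Re0 : re (0 : R[i]) = 0. Proof. by []. Qed.
Lemma Im0 : im (0 : R[i]) = 0. Proof. by []. Qed.

Definition cE := (ReD, ImD, ReN, ImN, ReM, ImM, ReJ, ImJ, Re1, Im1, Re0, Im0).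

(** The real part of [z * conjc w]. The projection is found in the underlying real Hilbert space;
    the imaginary part of the inner product comes back as the real product with [i * g], see
    [inner_dotL2]. *)
Definition dotc z w : R := re z * re w + im z * im w.

Lemma dotc_ge0 z : 0 <= dotc z z.
Proof. by rewrite /dotc -!expr2 addr_ge0 ?sqr_ge0. Qed.

Lemma cabs_sqr z : cabs z ^+ 2 = dotc z z.
Proof. by rewrite /cabs sqr_sqrtr -?expr2// addr_ge0 ?sqr_ge0. Qed.

Lemma cabs_ge0 z : 0 <= cabs z. Proof. exact: sqrtr_ge0. Qed.

Lemma dotc_le z w : `|dotc z w| <= dotc z z + dotc w w.
Proof.
case: z => a b; case: w => c e; rewrite /dotc /= ler_norml.
have := sqr_ge0 (a - c); have := sqr_ge0 (b - e).
have := sqr_ge0 (a + c); have := sqr_ge0 (b + e).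
have := sqr_ge0 a; have := sqr_ge0 b; have := sqr_ge0 c; have := sqr_ge0 e.
by move=> *; apply/andP; split; lra.
Qed.

Lemma dotcD_le z w : dotc (z + w) (z + w) <= 2 * dotc z z + 2 * dotc w w.
Proof.
case: z => a b; case: w => c e; rewrite /dotc !cE /=.
have := sqr_ge0 (a - c); have := sqr_ge0 (b - e).
by move=> *; lra.
Qed.

End ComplexParts.

Section OrthogonalProjection.
Context {R : realType} {X : ptopologicalType}.
Variable mu : {measure set (Borel X) -> \bar R}.
Implicit Types f g h : X -> R[i].

(** One shape serves sums, multiples and differences; in the projection argument differences are
    written [f x + Complex (-1) 0 * g x] to fit it. *)
Lemma cmeasurable_lin (c : R[i]) f g : cmeasurable f -> cmeasurable g ->
  cmeasurable (fun x => f x + c * g x).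
Proof.
move=> [f1 f2] [g1 g2]; split.
  under eq_fun do rewrite !cE.
  apply: measurable_funD => //.
  by apply: measurable_funB; apply: measurable_funM => //; exact: measurable_cst.
under eq_fun do rewrite !cE.
apply: measurable_funD => //.
by apply: measurable_funD; apply: measurable_funM => //; exact: measurable_cst.
Qed.

Lemma measurable_dotc f g : cmeasurable f -> cmeasurable g ->
  measurable_fun [set: Borel X] (fun x : Borel X => dotc (f x) (g x)).
Proof.
by move=> [f1 f2] [g1 g2]; apply: measurable_funD; apply: measurable_funM.
Qed.

Lemma L2P f : L2 mu f <-> cmeasurable f /\
  mu.-integrable [set: Borel X] (EFin \o (fun x : Borel X => dotc (f x) (f x))).
Proof.
rewrite /L2; have -> // : (fun x : Borel X => (cabs (f x) ^+ 2)%:E) =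
  EFin \o (fun x : Borel X => dotc (f x) (f x)).
by apply/funext => x; rewrite cabs_sqr.
Qed.

Definition dotL2 f g : R := \int[mu]_(x in [set: Borel X]) dotc (f x) (g x).

Lemma dotL2_int f g : L2 mu f -> L2 mu g ->
  mu.-integrable [set: Borel X] (EFin \o (fun x : Borel X => dotc (f x) (g x))).
Proof.
move=> /L2P[mf fi] /L2P[mg gi].
apply: (le_integrable measurableT _ _ (integrableD measurableT fi gi)).
  by apply/measurable_EFinP; exact: measurable_dotc.
move=> x _ /=; rewrite lee_fin [leRHS]ger0_norm; last by rewrite addr_ge0 ?dotc_ge0.
exact: dotc_le.
Qed.

Lemma L2norm2E f : L2 mu f -> L2norm2 mu f = (dotL2 f f)%:E.
Proof.
move=> fL; rewrite /dotL2 fineK; last exact: (integrable_fin_num measurableT (dotL2_int fL fL)).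
by apply: eq_integral => x _; rewrite cabs_sqr.
Qed.

Lemma L2_lin (c : R[i]) f g : L2 mu f -> L2 mu g -> L2 mu (fun x => f x + c * g x).
Proof.
move=> /[dup] fL /L2P[mf fi] /[dup] gL /L2P[mg gi]; apply/L2P.
have m := cmeasurable_lin c mf mg; split => //.
have ii := integrableD measurableT (integrableZl measurableT 2 fi)
  (integrableZl measurableT (2 * dotc c c) gi).
apply: (le_integrable measurableT _ _ ii).
  by apply/measurable_EFinP; exact: measurable_dotc.
move=> x _ /=; rewrite lee_fin !ger0_norm ?dotc_ge0//; last first.
  by rewrite addr_ge0// !mulr_ge0 ?dotc_ge0.
apply: (le_trans (dotcD_le _ _)); rewrite lerD2l -mulrA ler_pM2l//.
by rewrite /dotc !cE le_eqVlt; apply/orP; left; apply/eqP; ring.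
Qed.

Lemma dotL2_expand (t : R) f g : L2 mu f -> L2 mu g ->
  dotL2 (fun x => f x + Complex t 0 * g x) (fun x => f x + Complex t 0 * g x) =
  dotL2 f f + 2 * t * dotL2 f g + t ^+ 2 * dotL2 g g.
Proof.
move=> fL gL.
have ff := dotL2_int fL fL; have fg := dotL2_int fL gL; have gg := dotL2_int gL gL.
have fg' := integrableZl measurableT (2 * t) fg.
have gg' := integrableZl measurableT (t ^+ 2) gg.
rewrite /dotL2 -!RintegralZl// -RintegralD// -RintegralD//; last exact: (integrableD measurableT ff fg').
by apply: eq_Rintegral => x _; rewrite /dotc !cE /=; ring.
Qed.

Lemma dotL2_ge0 f : 0 <= dotL2 f f.
Proof. by apply: Rintegral_ge0 => x _; exact: dotc_ge0. Qed.

Lemma inner_dotL2 f g :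
  inner mu f g = Complex (dotL2 f g) (dotL2 f (fun x => Complex 0 1 * g x)).
Proof.
rewrite /inner /cint; congr (Complex _ _); congr fine; apply: eq_integral => x _.
  by rewrite !cE /dotc; congr EFin; ring.
by rewrite !cE /dotc !cE /=; congr EFin; ring.
Qed.

Lemma quadratic_nonneg_linear0 (a b : R) : 0 <= b ->
  (forall t, 0 <= 2 * t * a + t ^+ 2 * b) -> a = 0.
Proof.
move=> b0 h; apply/eqP; rewrite -sqrf_eq0; apply/eqP.
apply/eqP; rewrite eq_le sqr_ge0 andbT.
have b1 : 0 < b + 1 by rewrite ltr_wpDl.
(* The minimizer would be [- a / b]; the denominator [b + 1] also covers [b = 0] and still gives a
   negative value unless [a = 0]. *)
have := h (- a / (b + 1)).
have -> : 2 * (- a / (b + 1)) * a + (- a / (b + 1)) ^+ 2 * b =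
   - (a ^+ 2 * ((b + 2) / (b + 1) ^+ 2)).
  by field; rewrite gt_eqF.
rewrite oppr_ge0 pmulr_lle0//.
by rewrite divr_gt0 ?exprn_gt0// ltr_wpDl.
Qed.

(** The bound on the projection is stated for pairs related by [is_orth_proj], so it says something
    about [f] only once a partner is known to exist. The partner is the limit of a minimizing
    sequence whose errors [16^-n] suit [L2_fast_limit]. *)
Theorem orth_proj_exists (H : set (X -> R[i])) f : closed_L2_subspace mu H ->
  L2 mu f -> exists g, is_orth_proj mu H f g.
Proof.
move=> [HL H0 HD HZ Hcl] fL.
pose dist h := dotL2 (fun x => f x + Complex (-1) 0 * h x)
  (fun x => f x + Complex (-1) 0 * h x).
pose D := [set dist h | h in H].
have D0 : has_inf D.
  split; first by exists (dist (fun=> 0)), (fun=> 0).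
  by exists 0 => _ [h _ <-]; exact: dotL2_ge0.
set m := inf D.
have mle h : H h -> m <= dist h by move=> Hh; apply: ge_inf; [case: D0|exists h].
have m0 : 0 <= m by apply: lb_le_inf; [case: D0|move=> _ [h _ <-]; exact: dotL2_ge0].
have p16 n : 0 < (16 ^+ n)^-1 :> R by rewrite invr_gt0 exprn_gt0.
have /choice[h hP] : forall n, exists h, H h /\ dist h <= m + (16 ^+ n)^-1.
  by move=> n; have [_ [h Hh <-] /ltW ?] := inf_adherent (p16 n) D0; exists h.
have Hh n : H (h n) by case: (hP n).
have hL n : L2 mu (h n) by exact: HL.
have fhL k : H k -> L2 mu (fun x => f x + Complex (-1) 0 * k x).
  by move=> Hk; apply: L2_lin => //; exact: HL.
have diff_le n : dotL2 (fun x => h n.+1 x + Complex (-1) 0 * h n x)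
    (fun x => h n.+1 x + Complex (-1) 0 * h n x) <= 4 / 16 ^+ n.
  (* Parallelogram law: the midpoint lies in [H], so its distance is at least [m], and the squared
     step is at most twice the sum of the two excesses over [m]. *)
  pose mid x := Complex (1/2) 0 * (h n x + h n.+1 x).
  have Hmid : H mid by apply: HZ; exact: HD.
  have L0 := fhL _ (Hh n); have L1 := fhL _ (Hh n.+1); have Lm := fhL _ Hmid.
  have i0 := integrableZl measurableT 2 (dotL2_int L0 L0).
  have i1 := integrableZl measurableT 2 (dotL2_int L1 L1).
  have im := integrableZl measurableT (-4) (dotL2_int Lm Lm).
  have -> : dotL2 (fun x => h n.+1 x + Complex (-1) 0 * h n x)
      (fun x => h n.+1 x + Complex (-1) 0 * h n x) =
      2 * dist (h n) + 2 * dist (h n.+1) + - 4 * dist mid.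
    rewrite /dist /dotL2 -!RintegralZl//; try exact: dotL2_int.
    rewrite -RintegralD// -RintegralD//; last exact: (integrableD measurableT i0 i1).
    by apply: eq_Rintegral => x _; rewrite /dotc /mid !cE /=; field.
  have := mle _ Hmid; have [_] := hP n; have [_] := hP n.+1.
  have : (16 ^+ n.+1)^-1 <= (16 ^+ n)^-1 :> R.
    by rewrite lef_pV2 ?posrE ?exprn_gt0// ler_eXn2l// ltr1n.
  by move=> *; lra.
have part_le (part : R[i] -> R) : (forall z, part z ^+ 2 <= dotc z z) ->
    (forall z w, part (z + Complex (-1) 0 * w) = part z - part w) ->
    (forall n, measurable_fun [set: Borel X] (fun x : Borel X => part (h n x))) ->
    exists2 g : Borel X -> R, measurable_fun [set: Borel X] g &
      forall n, (\int[mu]_x ((g x - part (h n x)) ^+ 2)%:E <= (8 * 4 / 4 ^+ n)%:E)%E.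
  move=> partle partB mpart.
  apply: (@L2_fast_limit _ _ _ mu (fun n x => part (h n x)) 4) => // n.
  apply: (@le_trans _ _ (dotL2 (fun x => h n.+1 x + Complex (-1) 0 * h n x)
    (fun x => h n.+1 x + Complex (-1) 0 * h n x))%:E); last by rewrite lee_fin.
  have L := L2_lin (Complex (-1) 0) (hL n.+1) (hL n).
  rewrite -L2norm2E//; apply: ge0_le_integral => //.
  - by move=> x _; rewrite lee_fin sqr_ge0.
  - by apply/measurable_EFinP; apply: measurable_funX; exact: measurable_funB.
  - have /L2P[mL _] := L; under eq_fun do rewrite cabs_sqr.
    by apply/measurable_EFinP; exact: measurable_dotc.
  - by move=> x _; rewrite lee_fin cabs_sqr -partB.
have [gr mgr grh] : exists2 g : Borel X -> R, measurable_fun [set: Borel X] g &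
    forall n, (\int[mu]_x ((g x - re (h n x)) ^+ 2)%:E <= (8 * 4 / 4 ^+ n)%:E)%E.
  apply: part_le => [z|z w|n]; first by rewrite /dotc expr2 lerDl -expr2 sqr_ge0.
    by rewrite !cE /=; ring.
  by have [[? ?] _] := hL n.
have [gi mgi gih] : exists2 g : Borel X -> R, measurable_fun [set: Borel X] g &
    forall n, (\int[mu]_x ((g x - im (h n x)) ^+ 2)%:E <= (8 * 4 / 4 ^+ n)%:E)%E.
  apply: part_le => [z|z w|n]; first by rewrite /dotc expr2 lerDr -expr2 sqr_ge0.
    by rewrite !cE /=; ring.
  by have [[? ?] _] := hL n.
pose g x := Complex (gr x) (gi x).
have mg : cmeasurable g by [].
have ghm n : cmeasurable (fun x => g x + Complex (-1) 0 * h n x).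
  by apply: cmeasurable_lin => //; case: (hL n).
have gh_le n : (\int[mu]_(x in [set: Borel X]) (dotc (g x + Complex (-1) 0 * h n x)
    (g x + Complex (-1) 0 * h n x))%:E <= (64 / 4 ^+ n)%:E)%E.
  have -> : (64 / 4 ^+ n = 8 * 4 / 4 ^+ n + 8 * 4 / 4 ^+ n :> R) by field; rewrite expf_neq0.
  rewrite EFinD; apply: le_trans (leeD (grh n) (gih n)).
  have m1 : measurable_fun [set: Borel X] (fun x => ((gr x - re (h n x)) ^+ 2)%:E).
    apply/measurable_EFinP; apply: measurable_funX; apply: measurable_funB => //.
    by have [[? ?] _] := hL n.
  have m2 : measurable_fun [set: Borel X] (fun x => ((gi x - im (h n x)) ^+ 2)%:E).
    apply/measurable_EFinP; apply: measurable_funX; apply: measurable_funB => //.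
    by have [[? ?] _] := hL n.
  rewrite -ge0_integralD//.
  - rewrite le_eqVlt; apply/orP; left; apply/eqP; apply: eq_integral => x _.
    by rewrite -EFinD /dotc !cE /=; congr EFin; ring.
  - by move=> x _; rewrite lee_fin sqr_ge0.
  - by move=> x _; rewrite lee_fin sqr_ge0.
have ghL n : L2 mu (fun x => g x + Complex (-1) 0 * h n x).
  apply/L2P; split=> //; apply/integrableP; split.
    by apply/measurable_EFinP; exact: measurable_dotc.
  apply: le_lt_trans (ltry (64 / 4 ^+ n)); apply: le_trans (gh_le n).
  rewrite le_eqVlt; apply/orP; left; apply/eqP; apply: eq_integral => x _.
  by rewrite /= ger0_norm// dotc_ge0.
have gL : L2 mu g.
  have := L2_lin 1 (ghL 0) (hL 0).
  congr L2; apply/funext => x; apply: complex_eqP; rewrite !cE /=; ring.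
have gh_le' n : dotL2 (fun x => g x + Complex (-1) 0 * h n x)
    (fun x => g x + Complex (-1) 0 * h n x) <= 64 / 4 ^+ n.
  rewrite -lee_fin -L2norm2E//; apply: le_trans (gh_le n).
  rewrite le_eqVlt; apply/orP; left; apply/eqP.
  by apply: eq_integral => x _; rewrite cabs_sqr.
have Hg : H g.
  apply: Hcl => // e e0.
  have c0 : (fun n => 64 / 4 ^+ n) @ \oo --> (0 : R).
    rewrite -[X in _ --> X](mulr0 64); apply: cvgM; first exact: cvg_cst.
    under eq_fun do rewrite -exprVn.
    by apply: cvg_expr; rewrite ger0_norm ?invr_ge0// invf_lt1// ltr1n.
  move/cvgrPdist_lt : c0 => /(_ _ e0) [n _ /(_ n (leqnn n))].
  rewrite /= sub0r normrN => ne; exists (h n) => //.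
  have -> : (fun x => g x - h n x) = (fun x => g x + Complex (-1) 0 * h n x).
    by apply/funext => x; apply: complex_eqP; rewrite !cE /=; ring.
  rewrite L2norm2E// lte_fin; apply: le_lt_trans (gh_le' n) _.
  exact: le_lt_trans (ler_norm _) ne.
(* With [u = f - h n], [v = g - h n] and [q = 2^-n], positivity of the square of [u + 2^n v] gives
   [- 2 uv <= q uu + 2^n vv], in place of Cauchy-Schwarz. Since [uu <= m + q^4] and [vv <= 64 q^2],
   expanding [u - v] gives [dist g <= m + (m + 2 + 2 * 64) q]. *)
have dist_g : dist g <= m.
  apply: (@le_of_geometric_gap _ _ _ (m + 2 + 2 * 64)) => n.
  pose q : R := (2 ^+ n)^-1.
  have S0 : 0 < 2 ^+ n :> R by rewrite exprn_gt0.
  have q0 : 0 < q by rewrite invr_gt0.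
  have q1 : q <= 1 by rewrite invf_le1// exprn_ege1// ler1n.
  have qS : 2 ^+ n * q = 1 by rewrite mulfV// gt_eqF.
  have e16 : (16 ^+ n)^-1 = q ^+ 4.
    have -> : 16 = 2 ^+ 4 :> R by ring.
    by rewrite -exprM mulnC exprM exprVn.
  have e4 : 64 / 4 ^+ n = 64 * q ^+ 2.
    have -> : 4 = 2 ^+ 2 :> R by ring.
    by rewrite -exprM mulnC exprM exprVn.
  have q2 : q ^+ 2 <= q by rewrite expr2 ler_piMr// ltW.
  have q4 : q ^+ 4 <= q ^+ 2.
    have -> : q ^+ 4 = q ^+ 2 * q ^+ 2 by ring.
    by rewrite ler_piMr ?sqr_ge0//; lra.
  have Lu := fhL _ (Hh n); have Lv := ghL n.
  have E1 : dist g = dotL2 (fun x => f x + Complex (-1) 0 * h n x +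
        Complex (-1) 0 * (g x + Complex (-1) 0 * h n x))
      (fun x => f x + Complex (-1) 0 * h n x +
        Complex (-1) 0 * (g x + Complex (-1) 0 * h n x)).
    by apply: eq_Rintegral => x _; rewrite /dotc !cE /=; ring.
  have E2 := dotL2_ge0 (fun x => f x + Complex (-1) 0 * h n x +
    Complex (2 ^+ n) 0 * (g x + Complex (-1) 0 * h n x)).
  rewrite dotL2_expand// in E1; rewrite dotL2_expand// in E2.
  have [_] := hP n; have := gh_le' n; move: E1 E2; rewrite e16 e4 /dist.
  set vv := dotL2 (fun x => g x + _) _; set uv := dotL2 _ (fun x => g x + _).
  set gg := dotL2 (fun x => f x + Complex (-1) 0 * g x) _.
  set uu := dotL2 _ _ => -> big vvle uule.
  have : 0 <= q * (uu + 2 * 2 ^+ n * uv + (2 ^+ n) ^+ 2 * vv) by rewrite mulr_ge0// ltW.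
  have -> : q * (uu + 2 * 2 ^+ n * uv + (2 ^+ n) ^+ 2 * vv) =
     q * uu + (2 ^+ n * q) * 2 * uv + (2 ^+ n * q) * 2 ^+ n * vv by ring.
  rewrite qS; have Svv : 2 ^+ n * vv <= 64 * q.
    apply: le_trans (ler_wpM2l (ltW S0) vvle) _.
    have -> : 2 ^+ n * (64 * q ^+ 2) = 64 * (2 ^+ n * q) * q by ring.
    by rewrite qS mulr1.
  have quu : q * uu <= q * (m + 1).
    by apply: ler_wpM2l; [exact: ltW|lra].
  rewrite -/q => *; lra.
exists g; split => // k Hk.
(* Minimality along real multiples of [k'] kills the real product; applied to [k] and to [i * k] it
   gives complex orthogonality. *)
have orth k' : H k' -> dotL2 (fun x => f x - g x) k' = 0.
  move=> Hk'; have Lg := fhL _ Hg; have Lk := HL _ Hk'.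
  apply: (@quadratic_nonneg_linear0 _ (dotL2 k' k')); first exact: dotL2_ge0.
  move=> t.
  have -> : (fun x => f x - g x) = (fun x => f x + Complex (-1) 0 * g x).
    by apply/funext => x; apply: complex_eqP; rewrite !cE /=; ring.
  have := dotL2_expand t Lg Lk.
  have Hgk : H (fun x => g x + Complex (- t) 0 * k' x) by apply: HD => //; exact: HZ.
  have := mle _ Hgk.
  have -> : dist (fun x => g x + Complex (- t) 0 * k' x) =
    dotL2 (fun x => f x + Complex (-1) 0 * g x + Complex t 0 * k' x)
     (fun x => f x + Complex (-1) 0 * g x + Complex t 0 * k' x).
    by apply: eq_Rintegral => x _; rewrite /dotc !cE /=; ring.
  rewrite -/(dist g) => ? ?; lra.
rewrite inner_dotL2; apply: complex_eqP => /=; first exact: orth.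
by apply: orth; exact: HZ.
Qed.

End OrthogonalProjection.

(** * Uniform closure of an algebra of functions *)

Section ComplexModulus.
Context {R : realType}.
Implicit Types z w : R[i].

Lemma cabs_normc z : `|z| = Complex (cabs z) 0. Proof. exact: normc_def. Qed.

Lemma cabsM z w : cabs (z * w) = cabs z * cabs w.
Proof.
have := normrM z w; rewrite !cabs_normc => /(congr1 (@complex.Re R)).
by rewrite cE /= mulr0 subr0.
Qed.

Lemma cabsX z n : cabs (z ^+ n) = cabs z ^+ n.
Proof.
elim: n => [|n IH]; last by rewrite !exprS cabsM IH.
by rewrite !expr0 /cabs /= expr1n expr0n addr0 sqrtr1.
Qed.

Lemma cabsD z w : cabs (z + w) <= cabs z + cabs w.
Proof. by have := ler_normD z w; rewrite !cabs_normc lecE => /andP[_]. Qed.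

Lemma cabsN z : cabs (- z) = cabs z.
Proof. by rewrite /cabs !cE !sqrrN. Qed.

Lemma cabsB z w : cabs (z - w) = cabs (w - z).
Proof. by rewrite -cabsN opprB. Qed.

Lemma cabs_real (a : R) : cabs (Complex a 0) = `|a|.
Proof. by rewrite /cabs /= expr0n addr0 sqrtr_sqr. Qed.

Lemma cabs0_eq0 z : (cabs z == 0) = (z == 0).
Proof. by rewrite -[RHS]normr_eq0 cabs_normc eq_complex /= eqxx andbT. Qed.

Lemma cabs_gt0 z : (0 < cabs z) = (z != 0).
Proof. by rewrite lt_def cabs0_eq0 cabs_ge0 andbT. Qed.

Lemma cabsV z : cabs (z^-1) = (cabs z)^-1.
Proof.
have [->|z0] := eqVneq z 0.
  by rewrite invr0; have /eqP -> : cabs (0 : R[i]) == 0 by [rewrite cabs0_eq0]; rewrite invr0.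
apply: (mulfI (x := cabs z)); first by rewrite cabs0_eq0.
rewrite mulfV ?cabs0_eq0// -cabsM mulfV//.
by rewrite -[1]/(Complex 1 0) cabs_real normr1.
Qed.

Lemma ReV z : re z^-1 = re z / dotc z z.
Proof. by case: z => a b; rewrite /dotc -!expr2. Qed.

Lemma re_le_cabs z : `|re z| <= cabs z.
Proof.
rewrite -[`|_|]sqrtr_sqr ler_sqrt ?addr_ge0 ?sqr_ge0//.
by rewrite lerDl sqr_ge0.
Qed.

Lemma im_le_cabs z : `|im z| <= cabs z.
Proof.
rewrite -[`|_|]sqrtr_sqr ler_sqrt ?addr_ge0 ?sqr_ge0//.
by rewrite lerDr sqr_ge0.
Qed.

Lemma cabs_le_parts z : cabs z <= `|re z| + `|im z|.
Proof.
have zE : z = Complex (re z) 0 + Complex 0 1 * Complex (im z) 0.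
  by apply: complex_eqP; rewrite !cE /=; ring.
rewrite [in leLHS]zE; apply: le_trans (cabsD _ _) _; rewrite cabsM !cabs_real.
have -> : cabs (Complex 0 1 : R[i]) = 1.
  by rewrite /cabs /= expr0n expr1n add0r sqrtr1.
by rewrite mul1r.
Qed.

Lemma Re_sum n (F : nat -> R[i]) : re (\sum_(k < n) F k) = \sum_(k < n) re (F k).
Proof.
by elim: n => [|n IH]; rewrite ?big_ord0// !big_ord_recr/= cE IH.
Qed.

Lemma cabs_sum n (F : nat -> R[i]) : cabs (\sum_(k < n) F k) <= \sum_(k < n) cabs (F k).
Proof.
elim: n => [|n IH].
  by rewrite !big_ord0 le_eqVlt; apply/orP; left; rewrite cabs0_eq0.
by rewrite !big_ord_recr/=; apply: le_trans (cabsD _ _) _; rewrite lerD2r.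
Qed.

Lemma RtoC_D (a b : R) : Complex (a + b) 0 = Complex a 0 + Complex b 0.
Proof. by apply: complex_eqP; rewrite !cE /= ?addr0. Qed.

Lemma RtoC_M (a b : R) : Complex (a * b) 0 = Complex a 0 * Complex b 0.
Proof. by apply: complex_eqP; rewrite !cE /=; ring. Qed.

Lemma RtoC_V (a : R) : (Complex a 0)^-1 = Complex a^-1 0.
Proof.
apply: complex_eqP => /=; last by rewrite mul0r oppr0.
rewrite expr0n addr0; have [->|a0] := eqVneq a 0; first by rewrite invr0 mul0r.
by field.
Qed.

Lemma ln_sub_le (a b : R) : 0 < a -> 0 < b -> ln b - ln a <= b / a - 1.
Proof.
move=> a0 b0; rewrite -ln_div ?posrE//.
have := expR_ge1Dx (ln (b / a)); rewrite lnK ?posrE ?divr_gt0// => ?; lra.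
Qed.

End ComplexModulus.

Section UniformClosure.
Context {R : realType} {X : Type}.
Variable A : set (X -> R[i]).
Hypothesis A_cst : forall c : R[i], A (fun=> c).
Hypothesis A_D : forall f g, A f -> A g -> A (fun x => f x + g x).
Hypothesis A_M : forall f g, A f -> A g -> A (fun x => f x * g x).
Hypothesis A_bounded : forall f, A f -> exists K, forall x, cabs (f x) <= K.

Definition uclosure : set (X -> R[i]) :=
  [set b | forall e : R, 0 < e -> exists2 a, A a & forall x, cabs (b x - a x) < e].

Lemma sub_uclosure : A `<=` uclosure.
Proof.
move=> a Aa e e0; exists a => // x; rewrite subrr.
by have /eqP -> : cabs (0 : R[i]) == 0 by rewrite cabs0_eq0.
Qed.

Lemma uclosure_cst c : uclosure (fun=> c).
Proof. by apply: sub_uclosure; exact: A_cst. Qed.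

Lemma uclosure_bounded b : uclosure b ->
  exists2 K, 0 < K & forall x, cabs (b x) <= K.
Proof.
move=> /(_ 1 ltr01)[a Aa ba]; have [K aK] := A_bounded Aa.
exists (`|K| + 1) => [|x]; first by rewrite ltr_wpDl.
rewrite -[b x](subrK (a x)) addrC; apply: le_trans (cabsD _ _) _.
by rewrite lerD ?(ltW (ba _))//; apply: le_trans (aK x) (ler_norm _).
Qed.

Lemma uclosure_D f g : uclosure f -> uclosure g -> uclosure (fun x => f x + g x).
Proof.
move=> uf ug e e0; have e2 : 0 < e / 2 by rewrite divr_gt0.
have [a Aa fa] := uf _ e2; have [b Ab gb] := ug _ e2.
exists (fun x => a x + b x); first exact: A_D.
move=> x; have -> : f x + g x - (a x + b x) = (f x - a x) + (g x - b x) by ring.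
by apply: le_lt_trans (cabsD _ _) _; rewrite (splitr e) ltrD.
Qed.

Lemma uclosure_M f g : uclosure f -> uclosure g -> uclosure (fun x => f x * g x).
Proof.
move=> uf ug e e0.
have [K K0 fK] := uclosure_bounded uf; have [L L0 gL] := uclosure_bounded ug.
have ek : 0 < e / (2 * K) by rewrite divr_gt0// mulr_gt0.
(* The denominator contains a bound for the approximant [b] of [g], which is within [e / (2 * K)] of
   a function bounded by [L]. *)
have el : 0 < e / (2 * (L + e / (2 * K))) by rewrite divr_gt0// mulr_gt0// addr_gt0.
have [b Ab gb] := ug _ ek; have [a Aa fa] := uf _ el.
exists (fun x => a x * b x); first exact: A_M.
move=> x.
have -> : f x * g x - a x * b x = f x * (g x - b x) + (f x - a x) * b x by ring.
apply: le_lt_trans (cabsD _ _) _; rewrite !cabsM (splitr e).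
have bL : cabs (b x) <= L + e / (2 * K).
  rewrite -[b x](subrK (g x)) addrC; apply: le_trans (cabsD _ _) _.
  by rewrite lerD// cabsB ltW.
apply: ler_ltD.
  apply: (@le_trans _ _ (K * (e / (2 * K)))).
    by apply: ler_pM; rewrite ?cabs_ge0// ltW.
  by rewrite le_eqVlt; apply/orP; left; apply/eqP; field; rewrite gt_eqF.
apply: (@le_lt_trans _ _ (cabs (f x - a x) * (L + e / (2 * K)))).
  by apply: ler_wpM2l; rewrite ?cabs_ge0.
have M0 : 0 < L + e / (2 * K) by rewrite addr_gt0.
rewrite -ltr_pdivlMr//; apply: lt_le_trans (fa x) _.
by rewrite le_eqVlt; apply/orP; left; apply/eqP; rewrite invfM mulrA.
Qed.

Lemma uclosure_lim f : (forall e : R, 0 < e ->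
    exists2 g, uclosure g & forall x, cabs (f x - g x) < e) -> uclosure f.
Proof.
move=> uf e e0; have e2 : 0 < e / 2 by rewrite divr_gt0.
have [g ug fg] := uf _ e2; have [a Aa ga] := ug _ e2.
exists a => // x; have -> : f x - a x = (f x - g x) + (g x - a x) by ring.
by apply: le_lt_trans (cabsD _ _) _; rewrite (splitr e) ltrD.
Qed.

Lemma uclosure_X f n : uclosure f -> uclosure (fun x => f x ^+ n).
Proof.
move=> uf; elim: n => [|n IH].
  by under eq_fun do rewrite expr0; exact: uclosure_cst.
by under eq_fun do rewrite exprS; exact: uclosure_M.
Qed.

Lemma uclosure_sum n (F : nat -> X -> R[i]) : (forall k, (k < n)%N -> uclosure (F k)) ->
  uclosure (fun x => \sum_(k < n) F k x).
Proof.
elim: n => [|n IH] uF.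
  by under eq_fun do rewrite big_ord0; exact: uclosure_cst.
under eq_fun do rewrite big_ord_recr/=.
apply: uclosure_D; last exact: uF.
by apply: IH => k kn; apply: uF; exact: ltnW.
Qed.

Lemma neumann_series q (rho : R) : uclosure q -> rho < 1 ->
  (forall x, cabs (q x) <= rho) -> uclosure (fun x => (1 - q x)^-1).
Proof.
move=> uq rho1 qrho; apply: uclosure_lim => e e0.
(* On an empty [X] nothing forces [rho] to be nonnegative, and any member of the closure
   approximates. *)
have [x0|noX] := pselect (exists x : X, True); last first.
  by exists q => // x; exfalso; apply: noX; exists x.
have rho0 : 0 <= rho by case: x0 => x _; apply: le_trans (cabs_ge0 _) (qrho x).
have r0 : 0 < 1 - rho by rewrite subr_gt0.
have c0 : (fun n => rho ^+ n) @ \oo --> (0 : R) by apply: cvg_expr; rewrite ger0_norm.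
move/cvgrPdist_lt : c0 => /(_ (e * (1 - rho))); rewrite mulr_gt0// => /(_ isT).
move=> [n _ /(_ n (leqnn n))]; rewrite /= sub0r normrN ger0_norm ?exprn_ge0// => ne.
exists (fun x => \sum_(k < n) q x ^+ k).
  by apply: (@uclosure_sum n (fun k x => q x ^+ k)) => k _; exact: uclosure_X.
move=> x.
have low : 1 - rho <= cabs (1 - q x).
  have := cabsD (1 - q x) (q x); rewrite subrK -[1 in X in X <= _]/(Complex 1 0).
  by rewrite cabs_real normr1; have := qrho x => *; lra.
have nz : 1 - q x != 0 by rewrite -cabs_gt0; exact: lt_le_trans low.
have -> : (1 - q x)^-1 - \sum_(k < n) q x ^+ k = q x ^+ n * (1 - q x)^-1.
  have /(canRL (mulfK nz)) -> : (\sum_(k < n) q x ^+ k) * (1 - q x) = 1 - q x ^+ n.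
    by rewrite -[RHS]opprB subrX1; ring.
  by rewrite mulrBl mul1r opprB addrC subrK.
rewrite cabsM cabsX cabsV ltr_pdivrMr; last exact: lt_le_trans low.
apply: (@le_lt_trans _ _ (rho ^+ n)); first by rewrite lerXn2r ?nnegrE ?cabs_ge0.
by apply: lt_le_trans ne _; rewrite ler_pM2l.
Qed.

(* [1 + b = (1 + M) (1 - (M - b) / (1 + M))], and [M = K^2] makes the Neumann
   series converge when [|b| <= K] and [re b >= 0]. *)
Lemma right_half_plane_inv b : uclosure b -> (forall x, 0 <= re (b x)) ->
  uclosure (fun x => (1 + b x)^-1).
Proof.
move=> ub b0; have [K K0 bK] := uclosure_bounded ub.
have M1 : 0 < 1 + K ^+ 2 by rewrite ltr_pwDl// sqr_ge0.
pose c : R[i] := Complex (1 + K ^+ 2)^-1 0.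
pose q x := c * (Complex (K ^+ 2) 0 + (- 1) * b x).
have uq : uclosure q.
  apply: uclosure_M; first exact: uclosure_cst.
  apply: uclosure_D; first exact: uclosure_cst.
  by apply: uclosure_M => //; exact: uclosure_cst.
have cK : c * (1 + Complex (K ^+ 2) 0) = 1.
  by apply: complex_eqP; rewrite !cE /=; field; rewrite gt_eqF.
have -> : (fun x => (1 + b x)^-1) = (fun x => c * (1 - q x)^-1).
  apply/funext => x; have -> : 1 - q x = c * (1 + b x).
    by rewrite -[1 in LHS]cK /q; ring.
  have c0 : c != 0 by apply/eqP => c0; move: cK; rewrite c0 mul0r => /eqP; rewrite eq_sym oner_eq0.
  by rewrite invfM mulrA mulfV// mul1r.
apply: uclosure_M; first exact: uclosure_cst.
(* As [re b >= 0], the square of [|M - b|] is at most [M^2 + |b|^2 <= K^2 (1 + K^2)]; dividing by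
   [(1 + K^2)^2] gives [rho^2]. *)
pose rho := Num.sqrt (K ^+ 2 / (1 + K ^+ 2)).
apply: (neumann_series (rho := rho)) => //.
  rewrite -[ltRHS]sqrtr1 ltr_sqrt// ltr_pdivrMr// mul1r ltrDr//.
move=> x; rewrite /q cabsM cabs_real ger0_norm ?invr_ge0 ?(ltW M1)//.
rewrite -(@ler_pXn2r _ 2) ?nnegrE ?sqrtr_ge0//; last first.
  by rewrite mulr_ge0 ?cabs_ge0// invr_ge0 ltW.
have -> : rho ^+ 2 = K ^+ 2 / (1 + K ^+ 2).
  by rewrite sqr_sqrtr// divr_ge0 ?sqr_ge0// ltW.
rewrite exprMn.
rewrite exprVn ler_pdivrMl ?exprn_gt0//.
have -> : (1 + K ^+ 2) ^+ 2 * (K ^+ 2 / (1 + K ^+ 2)) = K ^+ 2 * (1 + K ^+ 2).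
  by field; rewrite gt_eqF.
rewrite cabs_sqr.
have bK2 : dotc (b x) (b x) <= K ^+ 2.
  by rewrite -cabs_sqr lerXn2r ?nnegrE ?cabs_ge0// ltW.
have := mulr_ge0 (sqr_ge0 K) (b0 x); move: bK2.
case: (b x) => r s; rewrite /dotc !cE /= => *; nra.
Qed.

End UniformClosure.

(** * Peaking functions at the end of a slit *)

Section Peaking.
Context {R : realType} {X : ptopologicalType}.
Hypothesis cX : compact [set: X].
Variable A : set (X -> R[i]).
Hypothesis A_cst : forall c : R[i], A (fun=> c).
Hypothesis A_D : forall f g, A f -> A g -> A (fun x => f x + g x).
Hypothesis A_M : forall f g, A f -> A g -> A (fun x => f x * g x).
Hypothesis A_bounded : forall f, A f -> exists K, forall x, cabs (f x) <= K.
Variable u : X -> R[i].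
Hypothesis Au : A u.
Hypothesis u_cont : ccontinuous u.
Hypothesis u_small : forall x, cabs (u x) <= 4^-1.
Hypothesis u_slit : forall x, im (u x) = 0 -> 0 <= re (u x).

Local Notation B := (uclosure A).

Let shift_neq0 x (s : R) : 0 < s -> u x + Complex s 0 != 0.
Proof.
move=> s0; apply/eqP => us.
have := congr1 (@complex.Re R) us; have := congr1 (@complex.Im R) us.
by rewrite !cE /= addr0 => /u_slit ? ?; lra.
Qed.

(** The squared modulus of [u + s] is continuous and positive on the compact product of [X] and
    [e, 1], so it has a positive minimum. For [e > 1] the range of [s] is empty. *)
Let shift_lower (e : R) : 0 < e -> exists2 delta, 0 < delta &
  forall x s, e <= s <= 1 -> delta <= cabs (u x + Complex s 0).
Proof.
move=> e0; have [e1|e1] := leP e 1; last first.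
  by exists 1 => // x s /andP[h1 h2]; exfalso; lra.
pose F (xs : X * R) := (re (u xs.1) + xs.2) ^+ 2 + im (u xs.1) ^+ 2.
have cF : continuous F.
  case: u_cont => c1 c2 xs.
  have d1 : {for xs, continuous (fun xs : X * R => re (u xs.1))}.
    by apply: (@continuous_comp _ _ _ fst (fun x => re (u x))); [exact: cvg_fst|exact: c1].
  have d2 : {for xs, continuous (fun xs : X * R => im (u xs.1))}.
    by apply: (@continuous_comp _ _ _ fst (fun x => im (u x))); [exact: cvg_fst|exact: c2].
  have d3 : {for xs, continuous (fun xs : X * R => xs.2)} by exact: cvg_snd.
  have d4 : {for xs, continuous (fun xs : X * R => re (u xs.1) + xs.2)} by exact: cvgD.
  under [F]eq_fun do rewrite /F !expr2.
  by apply: cvgD; apply: cvgM.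
have cK := compact_setX cX (@segment_compact R e 1).
have K0 : ([set: X] `*` `[e, 1]) !=set0.
  by exists (point, 1); split => //=; rewrite in_itv/= e1 lexx.
have [[x0 s0] /set_mem[_ /=]] := compact_EVT_min K0 cK (continuous_subspaceT cF).
rewrite in_itv/= => /andP[s01 s02] hmin.
have FE x s : F (x, s) = cabs (u x + Complex s 0) ^+ 2.
  by rewrite cabs_sqr /F /dotc !cE /= addr0 !expr2.
exists (cabs (u x0 + Complex s0 0)).
  by rewrite cabs_gt0; apply: shift_neq0; lra.
move=> x s se; rewrite -(@ler_pXn2r _ 2) ?nnegrE ?cabs_ge0// -!FE.
by apply: hmin; apply/mem_set; split => //=; rewrite in_itv.
Qed.

(** Resolvent identity: [u + s' = (u + s) (1 - (s - s') (u + s)^-1)], and the subtracted term has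
    modulus at most 1/2, within reach of the Neumann series. *)
Let resolvent_step (s s' delta : R) : 0 < s -> 0 < s' -> 0 < delta ->
  (forall x, delta <= cabs (u x + Complex s 0)) -> `|s - s'| <= delta / 2 ->
  B (fun x => (u x + Complex s 0)^-1) -> B (fun x => (u x + Complex s' 0)^-1).
Proof.
move=> s0 s'0 d0 dle ss' Bs.
have -> : (fun x => (u x + Complex s' 0)^-1) = (fun x => (u x + Complex s 0)^-1 *
    (1 - Complex (s - s') 0 * (u x + Complex s 0)^-1)^-1).
  apply/funext => x; rewrite -invfM; congr (_^-1).
  rewrite mulrBr mulr1 mulrCA mulfV ?shift_neq0// mulr1.
  by rewrite [in RHS]RtoC_D opprD addrA addrK; apply: complex_eqP; rewrite !cE /=; ring.
apply: uclosure_M => //; apply: (@neumann_series _ _ A A_cst A_D A_M A_bounded _ 2^-1) => //.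
- by apply: uclosure_M => //; exact: uclosure_cst.
- by rewrite invf_lt1// ltr1n.
move=> x; rewrite cabsM cabsV cabs_real ler_pdivrMr; last exact: lt_le_trans (dle x).
by apply: (le_trans ss'); rewrite mulrC ler_pM2l ?invr_gt0.
Qed.

Let resolvent1 : B (fun x => (u x + Complex 1 0)^-1).
Proof.
have -> : (fun x => (u x + Complex 1 0)^-1) = (fun x => (1 - (- 1) * u x)^-1).
  by apply/funext => x; congr (_^-1); rewrite -[Complex 1 0]/(1 : R[i]); ring.
apply: (@neumann_series _ _ A A_cst A_D A_M A_bounded _ 4^-1) => //.
- by apply: uclosure_M => //; [exact: uclosure_cst|exact: sub_uclosure].
- by rewrite invf_lt1// ltr1n.
by move=> x; rewrite mulN1r cabsN.
Qed.

(** Continuation down the slit: start at [s = 1], where [|u| <= 1/4] makes the Neumann series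
    converge, and descend by steps of [delta / 2], a length valid on all of [e, 1]. *)
Let resolvent (e s : R) : 0 < e -> e <= s <= 1 -> B (fun x => (u x + Complex s 0)^-1).
Proof.
move=> e0 es1; have [delta d0 dle] := shift_lower e0.
suff H n : forall s, e <= s <= 1 -> 1 - s <= n%:R * (delta / 2) ->
    B (fun x => (u x + Complex s 0)^-1).
  pose n := Num.bound ((1 - s) / (delta / 2)).
  apply: (H n) => //; rewrite -ler_pdivrMr ?divr_gt0//.
  apply: ltW; apply: archi_boundP; apply: divr_ge0; last by rewrite divr_ge0// ltW.
  by case/andP: es1 => _; rewrite subr_ge0.
elim: n => {s es1} [|n IH] s /andP[es s1].
  rewrite mul0r subr_le0 => s1'; have -> : s = 1 by apply/eqP; rewrite eq_le s1 s1'.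
  exact: resolvent1.
rewrite -natr1 mulrDl mul1r => h.
pose s' := Num.min 1 (s + delta / 2).
have d2 : 0 < delta / 2 by rewrite divr_gt0.
have s's : e <= s' <= 1 /\ s <= s' <= s + delta / 2.
  by rewrite /s' /Num.min; case: ifPn => ?; split; apply/andP; split; lra.
case: s's => s'1 /andP[s'2 s'3]; case/andP: (s'1) => s'4 s'5.
apply: (@resolvent_step s' s delta) => //; try lra.
- by move=> x; exact: dle.
- by rewrite ger0_norm; lra.
apply: IH => //; move: h; rewrite /s' /Num.min; case: ifPn => ? ?; last lra.
by rewrite subrr mulr_ge0// ltW.
Qed.

(* The Riemann sum [b] of [\int_e^1 (u + s)^-1 ds = ln ((u + 1) / (u + e))] has
   almost nonnegative real part because [|u + e| <= |u + 1|]; near the slit this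
   persists only because the mesh is finer than the distance of [-[e, 1]] to
   the range of [u]. *)
Let log_sum (e : R) : 0 < e -> e <= 4^-1 -> exists b (beta : R),
  [/\ - ln e <= beta, B b, (forall x, 0 <= re (b x)),
  (forall x, u x = 0 -> b x = Complex beta 0) &
  (forall x K, (forall s, 0 < s -> cabs (u x + Complex s 0)^-1 <= K) -> cabs (b x) <= K)].
Proof.
move=> e0 e4; have [delta d0 dle] := shift_lower e0.
(* The [N] quadratic errors [h^2 / delta^2] add up to [(1 - e)^2 / (N delta^2)], at most 1/2 for
   this [N]. *)
pose N := (Num.bound (2 / delta ^+ 2)).+1.
have N0 : 0 < N%:R :> R by rewrite ltr0n.
pose h := (1 - e) / N%:R.
have h0 : 0 < h by rewrite divr_gt0// subr_gt0; lra.
pose s k := e + k%:R * h.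
have sN : s N = 1 by rewrite /s /h mulrCA mulfV ?mulr1 ?gt_eqF//; lra.
have sS k : s k.+1 = s k + h by rewrite /s -natr1; ring.
have s_ge k : e <= s k by rewrite lerDl mulr_ge0// ltW.
have s_gt0 k : 0 < s k by apply: lt_le_trans (s_ge k).
have s_le k : (k <= N)%N -> s k <= 1.
  by move=> kN; rewrite -sN lerD2l ler_pM2r// ler_nat.
have hN : N%:R * (h ^+ 2 / delta ^+ 2) <= 2^-1.
  have d20 : 0 < delta ^+ 2 by rewrite exprn_gt0.
  have e1 : (1 - e) ^+ 2 <= 1 by rewrite expr_le1//; lra.
  have -> : N%:R * (h ^+ 2 / delta ^+ 2) = (1 - e) ^+ 2 / (N%:R * delta ^+ 2).
    by rewrite /h; field; rewrite !gt_eqF.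
  rewrite ler_pdivrMr ?mulr_gt0//; apply: le_trans e1 _.
  rewrite mulrC ler_pdivlMr// mul1r -ler_pdivrMr//.
  apply: (@le_trans _ _ (Num.bound (2 / delta ^+ 2))%:R); last by rewrite ler_nat.
  by apply: ltW; apply: archi_boundP; rewrite divr_ge0// ltW.
pose b x := Complex h 0 * \sum_(k < N) (u x + Complex (s k) 0)^-1.
have reb x : re (b x) = \sum_(k < N) h * re (u x + Complex (s k) 0)^-1.
  by rewrite /b cE /= mul0r subr0 (Re_sum N (fun k => (u x + Complex (s k) 0)^-1)) mulr_sumr.
(* The left Riemann sum of [1 / s] on [e, 1], which exceeds the integral [- ln e] because [1 / s]
   decreases. *)
exists b, (\sum_(k < N) h / s k); split.
- have step k : ln (s k.+1) - ln (s k) <= h / s k.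
    apply: le_trans (ln_sub_le (s_gt0 k) (s_gt0 k.+1)) _.
    by rewrite sS mulrDl divff ?gt_eqF// addrAC subrr add0r.
  apply: (@le_trans _ _ (ln (s N) - ln (s 0))).
    by rewrite sN ln1 sub0r /s mul0r addr0.
  rewrite -(telescope_sumr (fun k => ln (s k)) (leq0n N)) big_mkord.
  by apply: ler_sum => k _; exact: step.
- apply: uclosure_M => //; first exact: uclosure_cst.
  apply: (@uclosure_sum _ _ _ _ _ N (fun k x => (u x + Complex (s k) 0)^-1)) => // k kN.
  by apply: (@resolvent e) => //; rewrite s_ge s_le// ltnW.
- move=> x; pose m k := dotc (u x + Complex (s k) 0) (u x + Complex (s k) 0).
  have m0 k : 0 < m k.
    by rewrite /m -cabs_sqr exprn_gt0// cabs_gt0; exact: shift_neq0.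
  (* Here [ln (m k)] is [2 ln |u + s_k|]. Its increment is at most [m k.+1 / m k - 1], whose linear
     part is twice the k-th term of [re b], since [re z^-1 = re z / |z|^2]. *)
  have step k : (k < N)%N -> ln (m k.+1) - ln (m k) <=
      2 * (h * re (u x + Complex (s k) 0)^-1) + h ^+ 2 / delta ^+ 2.
    move=> kN; apply: le_trans (ln_sub_le (m0 k) (m0 k.+1)) _.
    have -> : m k.+1 / m k - 1 = 2 * (h * re (u x + Complex (s k) 0)^-1) + h ^+ 2 / m k.
      have -> : m k.+1 = m k + 2 * h * re (u x + Complex (s k) 0) + h ^+ 2.
        by rewrite /m /dotc !cE /= sS; ring.
      by rewrite ReV -/(m k); field; rewrite gt_eqF.
    rewrite lerD2l ler_wpM2l ?sqr_ge0// lef_pV2 ?posrE ?exprn_gt0//.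
    rewrite /m -cabs_sqr lerXn2r ?nnegrE ?cabs_ge0 ?(ltW d0)//.
    by apply: dle; rewrite s_ge s_le// ltnW.
  have tele : ln (m N) - ln (m 0) <= 2 * re (b x) + N%:R * (h ^+ 2 / delta ^+ 2).
    rewrite -(telescope_sumr (fun k => ln (m k)) (leq0n N)) big_mkord.
    have -> : N%:R * (h ^+ 2 / delta ^+ 2) = \sum_(k < N) (h ^+ 2 / delta ^+ 2).
      by rewrite sumr_const card_ord mulr_natl.
    rewrite reb mulr_sumr -big_split/=.
    by apply: ler_sum => k _; exact: step.
  (* From [|u| <= 1/4] and [e <= 1/4]: [|u + 1| >= 3/4] and [|u + e| <= 1/2]. So
     [ln (m N) - ln (m 0) >= 1 - 4/9 = 5/9], more than the total error 1/2, and [re b] is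
     nonnegative. *)
  have us := u_small x.
  have re4 := le_trans (re_le_cabs (u x)) us.
  have mN : 9 / 16 <= m N.
    rewrite /m sN -cabs_sqr.
    have -> : 9 / 16 = (3 / 4) ^+ 2 :> R by field.
    rewrite lerXn2r ?nnegrE ?cabs_ge0//.
    have := cabsD (u x + Complex 1 0) (- u x); rewrite cabsN addrAC subrr add0r cabs_real normr1 => ?.
    lra.
  have m00 : m 0 <= 1 / 4.
    rewrite /m -cabs_sqr /s mul0r addr0.
    have -> : 1 / 4 = (1 / 2) ^+ 2 :> R by field.
    rewrite lerXn2r ?nnegrE ?cabs_ge0//.
    by apply: le_trans (cabsD _ _) _; rewrite cabs_real ger0_norm ?(ltW e0)//; lra.
  have := ln_sub_le (m0 N) (m0 0).
  have : m 0 / m N <= 4 / 9.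
    rewrite ler_pdivrMr//; lra.
  by move: hN tele => *; lra.
- move=> x ux; rewrite /b ux.
  suff gen q : Complex h 0 * (\sum_(k < q) (0 + Complex (s k) 0)^-1) =
      Complex (\sum_(k < q) h / s k) 0 by exact: gen.
  elim: q => [|q IH].
    by rewrite !big_ord0 mulr0.
  rewrite !big_ord_recr/= mulrDr IH [in RHS]RtoC_D; congr (_ + _).
  by rewrite add0r RtoC_V -RtoC_M.
- move=> x K uK; rewrite /b cabsM cabs_real ger0_norm ?(ltW h0)//.
  have K0 : 0 <= K by apply: le_trans (cabs_ge0 _) (uK 1 ltr01).
  apply: (@le_trans _ _ (h * (N%:R * K))).
    rewrite ler_pM2l//; apply: le_trans (cabs_sum N (fun k => (u x + Complex (s k) 0)^-1)) _.
    have -> : N%:R * K = \sum_(k < N) K by rewrite sumr_const card_ord mulr_natl.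
    apply: ler_sum => k _.
    exact: uK.
  rewrite mulrA /h divfK ?gt_eqF// ler_piMl//; lra.
Qed.

(** The bound is uniform in [s], so off the zero set [b] stays bounded while its value [beta] on the
    zero set grows. It is [1 / re (u x)] when [u x] is real, hence positive by the slit condition,
    and [1 / |im (u x)|] otherwise. *)
Let resolvent_bound x : u x <> 0 ->
  exists2 K, 0 < K & forall s, 0 < s -> cabs (u x + Complex s 0)^-1 <= K.
Proof.
move=> ux; have [i0|i0] := eqVneq (im (u x)) 0.
  have r0 : 0 < re (u x).
    rewrite lt_def u_slit// andbT; apply/eqP => r0; apply: ux.
    exact: complex_eqP.
  exists (re (u x))^-1 => [|s s0]; first by rewrite invr_gt0.
  rewrite cabsV lef_pV2 ?posrE ?cabs_gt0 ?shift_neq0//.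
  apply: le_trans (le_trans (ler_norm _) (re_le_cabs _)).
  by rewrite cE /= lerDl ltW.
have n0 : 0 < `|im (u x)| by rewrite normr_gt0.
exists `|im (u x)|^-1 => [|s s0]; first by rewrite invr_gt0.
rewrite cabsV lef_pV2 ?posrE ?cabs_gt0 ?shift_neq0//.
by apply: le_trans (im_le_cabs _); rewrite cE /= addr0.
Qed.

Theorem peaking_sequence : exists c : nat -> X -> R[i],
  [/\ forall n, B (c n),
      forall n x, u x = 0 -> c n x = Complex 2^-1 0,
      forall n x, cabs (c n x) <= 2 &
      forall x, u x <> 0 -> (fun n => cabs (c n x)) @ \oo --> (0 : R)].
Proof.
(* Then [- ln (e n) = n + 2] bounds [beta] from below, and the offset 2 ensures [e n <= 1/4]. *)
pose e n : R := expR (- n.+2%:R).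
have e4 n : e n <= 4^-1.
  rewrite /e expRN lef_pV2 ?posrE ?expR_gt0//.
  rewrite -[n.+2%:R]natr1 expRD.
  have -> : 4 = 2 * 2 :> R by ring.
  apply: ler_pM => //; apply: le_trans (expR_ge1Dx _).
    by rewrite -(natr1 n); have := ler0n R n; lra.
  by [].
have /choice[b /choice[beta bP]] : forall n, exists b (beta : R),
    [/\ n.+2%:R <= beta, B b, (forall x, 0 <= re (b x)),
    (forall x, u x = 0 -> b x = Complex beta 0) &
    (forall x K, (forall s, 0 < s -> cabs (u x + Complex s 0)^-1 <= K) -> cabs (b x) <= K)].
  move=> n; have [b [beta [h ? ? ? ?]]] := log_sum (expR_gt0 _) (e4 n).
  by exists b, beta; split => //; rewrite expRK opprK in h.
have n2 n : 0 < n.+2%:R :> R by rewrite ltr0n.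
have beta0 n : 0 < beta n by case: (bP n) => + _ _ _ _; exact: lt_le_trans.
pose v n x := Complex (beta n)^-1 0 * b n x.
have rev n x : 0 <= re (v n x).
  rewrite /v cE /= mul0r subr0 mulr_ge0 ?invr_ge0 ?(ltW (beta0 n))//.
  by have [_ _ + _ _] := bP n; exact.
have uv n : B (v n).
  have [_ bn _ _ _] := bP n.
  by apply: uclosure_M => //; exact: uclosure_cst.
have low n x : 1 <= cabs (1 + v n x).
  apply: le_trans (le_trans (ler_norm _) (re_le_cabs _)).
  by rewrite ReD Re1 lerDl.
have nz n x : 1 + v n x != 0 by rewrite -cabs_gt0; exact: lt_le_trans (low n x).
exists (fun n x => 1 + (- 1) * (1 + v n x)^-1); split.
- move=> n; apply: uclosure_D => //; first exact: uclosure_cst.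
  apply: uclosure_M => //; first exact: uclosure_cst.
  exact: (right_half_plane_inv A_cst A_D A_M A_bounded).
- move=> n x ux; have -> : v n x = 1.
    rewrite /v; have [_ _ _ /(_ _ ux) -> _] := bP n.
    by apply: complex_eqP; rewrite !cE /=; field; rewrite gt_eqF.
  have -> : 1 + 1 = Complex 2 0 :> R[i] by apply: complex_eqP; rewrite !cE /= ?addr0.
  by rewrite RtoC_V; apply: complex_eqP; rewrite !cE /=; field.
- move=> n x; apply: le_trans (cabsD _ _) _.
  rewrite mulN1r cabsN cabsV -[X in cabs X + _]/(Complex 1 0 : R[i]) cabs_real normr1.
  have : (cabs (1 + v n x))^-1 <= 1 by rewrite invf_le1// (lt_le_trans _ (low n x)).
  by move=> ?; lra.
- move=> x /resolvent_bound[K K0 hK].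
  (* In this form the decay is visible: [|1 + v| >= 1] and [|v| <= K / beta]. *)
  have cE' n : 1 + (- 1) * (1 + v n x)^-1 = v n x * (1 + v n x)^-1.
    by move: (nz n x); move: (v n x) => z z0; field.
  have bound n : cabs (1 + (- 1) * (1 + v n x)^-1) <= K * n.+1%:R^-1.
    rewrite cE' cabsM cabsV ler_pdivrMr ?(lt_le_trans _ (low n x))//.
    apply: (@le_trans _ _ (K * n.+1%:R^-1)); last first.
      by rewrite ler_peMr// mulr_ge0 ?invr_ge0// ltW.
    rewrite /v cabsM cabs_real ger0_norm ?invr_ge0 ?(ltW (beta0 n))// mulrC.
    have [bn _ _ _ /(_ _ _ hK) bK] := bP n.
    apply: ler_pM => //; first exact: cabs_ge0.
      by rewrite invr_ge0 ltW.
    rewrite lef_pV2 ?posrE//; apply: le_trans bn; by rewrite ler_nat.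
  have c0 : (fun n => K * n.+1%:R^-1) @ \oo --> (0 : R).
    rewrite -[X in _ --> X](mulr0 K); apply: cvgM; first exact: cvg_cst.
    exact: cvg_harmonic.
  apply: (squeeze_cvgr _ (cvg_cst 0) c0).
  by apply: nearW => n; rewrite cabs_ge0 bound.
Qed.

End Peaking.

(** * A null level with an accessible endpoint *)

Section PeakPoint.
Context {R : realType} {X : ptopologicalType}.

(** After normalization of [mu], these levels are the atoms of the law of [f]. The zero measure
    cannot be normalized and is treated apart. *)
Lemma level_gt0_countable (mu : {finite_measure set (Borel X) -> \bar R})
  (f : Borel X -> R) : measurable_fun [set: Borel X] f ->
  countable [set t : R | (0 < mu (f @^-1` [set t]))%E].
Proof.
move=> mf.
have mlev t : measurable (f @^-1` [set t]).
  by rewrite -[_ @^-1` _]setTI; apply: mf => //; exact: measurable_set1.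
have [m0|m0] := eqVneq (mu setT) 0%E.
  suff -> : [set t : R | (0 < mu (f @^-1` [set t]))%E] = set0 by exact: countable0.
  apply/seteqP; split=> // t /=; rewrite ltNge => /negP; apply.
  by rewrite -m0; apply: le_measure; rewrite ?inE.
pose P : probability (Borel X) R := mnormalize mu (dirac point).
pose f' : {RV P >-> R} := mfun_Sub (mem_set mf).
apply: sub_countable (subset_card_le _) (pmf_gt0_countable f') => t /= ft.
have mfin : mu setT \is a fin_num by exact: fin_num_measure.
have -> : pmf f' t = fine (mu (f @^-1` [set t]) * (fine (mu setT))^-1%:E).
  rewrite /pmf /= /mnormalize (negbTE m0)/=.
  by case: ifPn => // /eqP moo; move: mfin; rewrite moo.
have tfin : mu (f @^-1` [set t]) \is a fin_num by exact: fin_num_measure.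
rewrite fineM//= mulr_gt0//.
  by rewrite fine_gt0// ft/= ltey_eq tfin.
by rewrite invr_gt0 fine_gt0// lt0e m0 measure_ge0 ltey_eq mfin.
Qed.

(** Connectedness puts the whole interval [f x, f y] in the range. If no level were null, this
    interval would be countable, against its positive Lebesgue measure. *)
Lemma exists_null_level (mu : {finite_measure set (Borel X) -> \bar R}) (f : X -> R) :
  connected [set: X] -> continuous f -> (exists x y, f x != f y) ->
  exists x, mu ((f : Borel X -> R) @^-1` [set f x]) = 0%E.
Proof.
move=> conn cf [x [y]].
wlog xy : x y / f x < f y => [hw|_].
  by move=> nxy; have := nxy; rewrite neq_lt => /orP[|] /hw; apply; rewrite // eq_sym.
have itv : is_interval (f @` setT).
  apply/connected_intervalP; apply: connected_continuous_connected => //.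
  exact: continuous_subspaceT.
apply: contrapT => nx.
have sub : `[f x, f y]%classic `<=` [set t : R | (0 < mu ((f : Borel X -> R) @^-1` [set t]))%E].
  move=> t /=; rewrite in_itv/= => txy.
  have [|| z _ zt] := itv (f x) (f y) _ _ t txy; [by exists x|by exists y|].
  rewrite lt0e measure_ge0 andbT; apply/eqP => m0; apply: nx; exists z.
  by rewrite zt.
have cnt : countable `[f x, f y]%classic.
  exact: sub_countable (subset_card_le sub) (level_gt0_countable mu (continuous_Borel cf)).
have := countable_lebesgue_measure0 cnt; rewrite lebesgue_measure_itv/= lte_fin xy.
by rewrite -EFinB => -[] /eqP; rewrite subr_eq0 gt_eqF.
Qed.

Lemma closed_zeros (u : X -> R[i]) : ccontinuous u -> closed [set x | u x = 0].
Proof.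
move=> [cr ci].
have -> : [set x | u x = 0] = [set x | re (u x) = 0] `&` [set x | im (u x) = 0].
  by apply/seteqP; split=> x /= => [->//|[? ?]]; exact: complex_eqP.
apply: closedI.
  by apply: (@closed_comp _ _ (fun x => re (u x)) [set 0]) => [x _|]; [exact: cr|exact: closed_eq].
by apply: (@closed_comp _ _ (fun x => im (u x)) [set 0]) => [x _|]; [exact: ci|exact: closed_eq].
Qed.

(* At a generic abscissa [t], the highest point [f x0] of the range of [f] on the
   line [re = t] is the endpoint of a vertical ray avoiding the rest of the range;
   [u] is [f - f x0], rotated so that this ray becomes the negative real axis. *)
Lemma exists_peak_point (mu : {finite_measure set (Borel X) -> \bar R})
  (A : set (X -> R[i])) :
  compact [set: X] -> connected [set: X] ->
  (forall f, A f -> ccontinuous f) ->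
  (forall c : R[i], A (fun=> c)) ->
  (forall f g, A f -> A g -> A (fun x => f x + g x)) ->
  (forall f g, A f -> A g -> A (fun x => f x * g x)) ->
  (exists2 f, A f & exists x y, f x != f y) ->
  exists u x0, [/\ A u, u x0 = 0, (forall x, cabs (u x) <= 4^-1),
    (forall x, im (u x) = 0 -> 0 <= re (u x)) &
    mu [set x : Borel X | u x = 0] = 0%E].
Proof.
move=> cX conn Ac Acst AD AM nonconst.
(* If two values differ only in their imaginary parts, multiplication by [i] moves the difference to
   the real parts. *)
have [f Af fxy] : exists2 f, A f & exists x y, re (f x) != re (f y).
  have [f Af [x [y fxy]]] := nonconst.
  have [rxy|rxy] := eqVneq (re (f x)) (re (f y)); last by exists f => //; exists x, y.
  exists (fun x => Complex 0 1 * f x); first exact: AM.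
  exists x, y; rewrite !cE /= !mul0r !mul1r !sub0r eqr_opp.
  by apply: contraNneq fxy => ixy; apply/eqP; exact: complex_eqP.
have [cr ci] := Ac _ Af.
have [x1 null] := exists_null_level mu conn cr fxy.
pose L := [set x | re (f x) = re (f x1)].
have cL : compact L.
  apply: (subclosed_compact _ cX) => //.
  apply: (@closed_comp _ _ (fun x => re (f x)) [set re (f x1)]).
    by move=> x _; exact: cr.
  exact: closed_eq.
have L0 : L !=set0 by exists x1.
have [x0 /set_mem Lx0 x0max] := compact_EVT_max L0 cL (continuous_subspaceT ci).
have [Kr Kr0 fKr] := compact_continuous_bounded cX cr.
have [Ki Ki0 fKi] := compact_continuous_bounded cX ci.
(* Since [|f - f x0| <= 2 (Kr + Ki)], this scale gives [|u| <= 1/4]. *)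
pose k := (8 * (Kr + Ki))^-1.
have k0 : 0 < k by rewrite invr_gt0 mulr_gt0// addr_gt0.
pose u x := Complex 0 k * (f x + (- 1) * f x0).
have reu x : re (u x) = k * (im (f x0) - im (f x)) by rewrite /u !cE /=; ring.
have imu x : im (u x) = k * (re (f x) - re (f x0)) by rewrite /u !cE /=; ring.
exists u, x0; split.
- by apply: AM => //; apply: AD => //; exact: AM.
- by apply: complex_eqP; rewrite ?reu ?imu !subrr mulr0.
- move=> x; rewrite /cabs.
  apply: (@le_trans _ _ (Num.sqrt (4^-1 ^+ 2))); last by rewrite sqrtr_sqr ger0_norm.
  rewrite ler_sqrt ?sqr_ge0// reu imu.
  have hr : `|re (f x) - re (f x0)| <= 2 * Kr.
    by apply: le_trans (ler_normB _ _) _; have := fKr x; have := fKr x0; lra.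
  have hi : `|im (f x0) - im (f x)| <= 2 * Ki.
    by apply: le_trans (ler_normB _ _) _; have := fKi x; have := fKi x0; lra.
  rewrite !exprMn -mulrDr.
  rewrite -(real_normK (num_real (re (f x) - _))) -(real_normK (num_real (im (f x0) - _))).
  have -> : 4^-1 ^+ 2 = k ^+ 2 * (2 * (Kr + Ki)) ^+ 2.
    by rewrite /k; field; rewrite gt_eqF// addr_gt0.
  rewrite ler_pM2l ?exprn_gt0//.
  apply: (@le_trans _ _ ((2 * Ki) ^+ 2 + (2 * Kr) ^+ 2)).
    by apply: lerD; rewrite lerXn2r// nnegrE mulr_ge0// ltW.
  by have := mulr_gt0 Kr0 Ki0 => ?; nra.
- move=> x; rewrite imu reu => /eqP; rewrite mulf_eq0 gt_eqF//= subr_eq0 => /eqP fx.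
  rewrite mulr_ge0 ?(ltW k0)// subr_ge0; apply: x0max; apply/mem_set.
  by rewrite /L /= fx.
- apply/eqP; rewrite eq_le measure_ge0 andbT -null; apply: le_measure.
  + rewrite inE; apply: closed_Borel; apply: closed_zeros; apply: Ac.
    by apply: AM => //; apply: AD => //; exact: AM.
  + rewrite inE -[X in measurable X]setTI; apply: (continuous_Borel cr) => //.
  + move=> x /= ux; have := imu x; rewrite ux /= => /esym/eqP.
    by rewrite mulf_eq0 gt_eqF//= subr_eq0 => /eqP ->.
Qed.

End PeakPoint.

(** * The limit measure *)

Lemma bounded_convergence d (T : measurableType d) (R : realType)
  (m : {finite_measure set T -> \bar R}) (f_ : nat -> T -> R) (f : T -> R) (M : R) :
  (forall n, measurable_fun setT (f_ n)) -> (forall n x, `|f_ n x| <= M) ->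
  (forall x, (f_ ^~ x) @ \oo --> f x) ->
  measurable_fun setT f /\ (fun n => \int[m]_x f_ n x) @ \oo --> \int[m]_x f x.
Proof.
move=> mf_ fM ff.
have mE n : measurable_fun setT (EFin \o f_ n) by exact/measurable_EFinP.
have ffE x : [set: T] x -> (fun n => (EFin \o f_ n) x) @ \oo --> (EFin \o f) x.
  by move=> _; apply: cvg_EFin; [apply: nearW => n|exact: ff].
have mf : measurable_fun setT (EFin \o f) by exact: (emeasurable_fun_cvg _ _ mE ffE).
split; first exact/measurable_EFinP.
have iM : m.-integrable setT (EFin \o (fun=> M : R)) by exact: finite_measure_integrable_cst.
have fMb x : `|f x| <= M.
  have c : (fun n => `|f_ n x|) @ \oo --> `|f x| by apply: cvg_norm; exact: ff.
  exact: (cvg_le_lim c (cvg_cst M)).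
apply: fine_cvg; rewrite fineK; last first.
  apply: (integrable_fin_num measurableT).
  by apply: (bounded_integrable m _ fMb); exact/measurable_EFinP.
apply: (dominated_cvg (g := EFin \o (fun=> M : R)) measurableT mE ffE _ iM) => // n x _.
by rewrite /= lee_fin; exact: fM.
Qed.

Lemma filter_forall_ltn (T : Type) (F : set_system T) (n : nat) (P : nat -> set T) :
  Filter F -> (forall i, (i < n)%N -> F (P i)) ->
  F [set x | forall i, (i < n)%N -> P i x].
Proof.
move=> FF; elim: n => [|n IH] FP; first by apply: filterS filterT => x _ i.
have FI := IH (fun i ilt => FP i (ltnW ilt)).
apply: filterS (filterI FI (FP n (ltnSn n))) => x [h1 h2] i.
by rewrite ltnS leq_eqVlt => /predU1P[->//|]; exact: h1.
Qed.

Section SignedRegular.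
Context {R : realType} {X : ptopologicalType}.
Implicit Types p q : {finite_measure set (Borel X) -> \bar R}.

Definition diff_charge p q : {charge set (Borel X) -> \bar R} :=
  cadd (charge_of_finite_measure p) (copp (charge_of_finite_measure q)).

Lemma diff_chargeE p q E : diff_charge p q E = (p E - q E)%E.
Proof. by []. Qed.

Lemma fine_diff_charge p q (E : set (Borel X)) : measurable E ->
  `|fine (diff_charge p q E)| <= fine (p E) + fine (q E).
Proof.
move=> mE; rewrite diff_chargeE fineB ?fin_num_measure//.
by apply: le_trans (ler_normB _ _) _; rewrite !ger0_norm ?fine_ge0.
Qed.

(** Each of the four measures gets a share [e / 4]; uniting the compact sets and intersecting the
    open ones serves all of them at once. *)
Lemma cregular_diff_charge p1 q1 p2 q2 : hausdorff_space X ->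
  regular_measure p1 -> regular_measure q1 ->
  regular_measure p2 -> regular_measure q2 ->
  cregular (diff_charge p1 q1) (diff_charge p2 q2).
Proof.
move=> hX rp1 rq1 rp2 rq2 E mE e e0; have e4 : 0 < e / 4 by rewrite divr_gt0.
have [K1 [U1 [cK1 oU1 KE1 EU1 h1]]] := rp1 E mE _ e4.
have [K2 [U2 [cK2 oU2 KE2 EU2 h2]]] := rq1 E mE _ e4.
have [K3 [U3 [cK3 oU3 KE3 EU3 h3]]] := rp2 E mE _ e4.
have [K4 [U4 [cK4 oU4 KE4 EU4 h4]]] := rq2 E mE _ e4.
exists (K1 `|` K2 `|` (K3 `|` K4)), (U1 `&` U2 `&` (U3 `&` U4)); split.
- by apply: compactU; apply: compactU.
- by apply: openI; apply: openI.
- by rewrite !subUset.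
- by rewrite !subsetI.
move=> B mB BUK.
have small (p : {finite_measure set (Borel X) -> \bar R}) (K U : set X) :
    compact K -> open U -> (p (U `\` K : set (Borel X)) < (e / 4)%:E)%E ->
    B `<=` U `\` K -> fine (p B) < e / 4.
  move=> cK oU pUK BUK'; rewrite -lte_fin fineK ?fin_num_measure//.
  apply: le_lt_trans pUK; apply: le_measure => //; rewrite inE//.
  apply: measurableD; first exact: open_Borel.
  by apply: closed_Borel; exact: compact_closed.
have s1 : fine (p1 B) < e / 4.
  by apply: (small _ K1 U1) => // x /BUK[[[? ?] [? ?]] nK]; split=> // Kx; apply: nK; left; left.
have s2 : fine (q1 B) < e / 4.
  by apply: (small _ K2 U2) => // x /BUK[[[? ?] [? ?]] nK]; split=> // Kx; apply: nK; left; right.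
have s3 : fine (p2 B) < e / 4.
  by apply: (small _ K3 U3) => // x /BUK[[[? ?] [? ?]] nK]; split=> // Kx; apply: nK; right; left.
have s4 : fine (q2 B) < e / 4.
  by apply: (small _ K4 U4) => // x /BUK[[[? ?] [? ?]] nK]; split=> // Kx; apply: nK; right; right.
have d1 := fine_diff_charge p1 q1 mB; have d2 := fine_diff_charge p2 q2 mB.
apply: le_lt_trans (cabs_le_parts _) _; rewrite /cmeas_val /=; lra.
Qed.

End SignedRegular.

Section LimitCharge.
Context {R : realType} {X : ptopologicalType}.
Hypotheses (cX : compact [set: X]) (hX : hausdorff_space X).
Variable mu : {finite_measure set (Borel X) -> \bar R}.
Hypothesis mu_supp : full_support mu.
Variable H : set (X -> R[i]).
Hypothesis hH : closed_L2_subspace mu H.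
Variable C : R.
Hypothesis Pi_bounded : forall f g : X -> R[i], L2 mu f -> is_orth_proj mu H f g ->
  (L1norm mu g <= C%:E * L1norm mu f)%E.
Variable x0 : X.

Let nbd : Type := {V : set X | open V /\ V x0}.

(** The filter of neighbourhoods shrinking to [x0]; a sequence would not do, as [X] may fail to be
    first countable. *)
Let shrink : set_system nbd :=
  filter_from (nbhs x0) (fun W => [set V : nbd | sval V `<=` W]).

Let shrink_proper : ProperFilter shrink.
Proof.
apply: filter_from_proper.
  apply: filter_from_filter; first by exists setT; exact: filterT.
  move=> V W nV nW; exists (V `&` W); first exact: filterI.
  by move=> S SVW; split; apply: (subset_trans SVW); [exact: subIsetl|exact: subIsetr].
move=> W nW; have oW : open W° /\ W° x0 by split => //; exact: open_interior.
by exists (exist _ (W°) oW : nbd) => /=; exact: interior_subset.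
Qed.

Let mV (V : nbd) : measurable (sval V : set (Borel X)).
Proof. by case: V => V [oV Vx0] /=; exact: open_Borel. Qed.

Let mass (V : nbd) : R := fine (mu (sval V : set (Borel X))).

Let mass_gt0 V : 0 < mass V.
Proof.
rewrite fine_gt0// ltey_eq fin_num_measure ?mV//= andbT.
by case: V => V [oV Vx0] /=; apply: mu_supp => //; exists x0.
Qed.

Let w (V : nbd) : Borel X -> R := fun x => \1_(sval V : set (Borel X)) x / mass V.

Let w_ge0 V x : 0 <= w V x.
Proof. by rewrite divr_ge0// ltW. Qed.

Let w_meas V : measurable_fun setT (w V).
Proof. by apply: measurable_funM => //; exact: measurable_indic (mV V). Qed.

Let w_le V x : `|w V x| <= (mass V)^-1.
Proof.
by rewrite ger0_norm// ler_piMl ?invr_ge0 ?(ltW (mass_gt0 V))//.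
Qed.

Let w_int V : mu.-integrable setT (EFin \o w V).
Proof. exact: bounded_integrable (w_meas V) (w_le V). Qed.

Let w_mass V : \int[mu]_x w V x = 1.
Proof.
have i1 : mu.-integrable setT (EFin \o (\1_(sval V : set (Borel X)) : Borel X -> R)).
  apply: (@bounded_integrable _ _ _ _ _ 1); first by apply: measurable_indic; exact: mV.
  by move=> x; rewrite indicE; case: (_ \in _); rewrite ?normr1 ?normr0.
rewrite RintegralZr// /Rintegral integral_indic// setIT -/(mass V).
by rewrite mulfV// gt_eqF.
Qed.

Let f (V : nbd) : X -> R[i] := fun x => Complex (w V x) 0.

Let f_L2 V : L2 mu (f V).
Proof.
apply/L2P; split; first by split => //=; exact: measurable_cst.
apply: (@bounded_integrable _ _ _ _ _ ((mass V)^-1 ^+ 2)).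
  by apply: measurable_dotc; split => //=; exact: measurable_cst.
move=> x; rewrite /dotc /= mulr0 addr0 -expr2 ger0_norm ?sqr_ge0//.
rewrite lerXn2r ?nnegrE ?invr_ge0 ?(ltW (mass_gt0 V))//.
by have := w_le V x; rewrite ger0_norm.
Qed.

Let f_L1 V : L1norm mu (f V) = 1%E.
Proof.
rewrite -(w_mass V) /Rintegral fineK; last exact: integrable_fin_num (w_int V).
by apply: eq_integral => x _; rewrite cabs_real ger0_norm.
Qed.

Let proj : exists g : nbd -> X -> R[i], forall V, is_orth_proj mu H (f V) (g V).
Proof.
by have [g gP] := choice (fun V => orth_proj_exists hH (f_L2 V)); exists g.
Qed.

Lemma average_cvg (psi : X -> R) : continuous psi ->
  (fun V => \int[mu]_x (psi x * w V x)) @ shrink --> psi x0.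
Proof.
have FF := shrink_proper; move=> cpsi; apply/cvgrPdist_le => e e0.
have /cvgrPdist_le/(_ e e0) We := cpsi x0.
exists [set x | `|psi x0 - psi x| <= e]; first exact: We.
move=> V /= VW.
have [B B0 psiB] := compact_continuous_bounded cX cpsi.
have ipsi := integrableM_bounded (continuous_Borel cpsi) psiB (w_int V).
have icst := integrableZl measurableT (psi x0) (w_int V).
have -> : psi x0 - \int[mu]_x (psi x * w V x) = \int[mu]_x ((psi x0 - psi x) * w V x).
  rewrite -[X in X - _]mulr1 -(w_mass V) -RintegralZl// -RintegralB//.
  by apply: eq_Rintegral => x _; ring.
have idiff : mu.-integrable setT (EFin \o (fun x : Borel X => (psi x0 - psi x) * w V x)).
  apply: (integrableM_bounded (B := `|psi x0| + B)) => //.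
    by apply: measurable_funB => //; exact: continuous_Borel.
  by move=> x; apply: le_trans (ler_normB _ _) _; rewrite lerD2l.
apply: (le_trans (le_normr_Rintegral measurableT idiff)).
apply: (@le_trans _ _ (\int[mu]_x (e * w V x))); last by rewrite RintegralZl// w_mass mulr1.
apply: le_RintegralT.
- exact: integrable_norm idiff.
- exact: (integrableZl measurableT e (w_int V)).
move=> x; rewrite normrM (ger0_norm (w_ge0 V x)).
rewrite /w indicE; have [/set_mem Vx|_] := boolP (x \in _); last by rewrite mul0r !mulr0.
by apply: ler_wpM2r; [rewrite divr_ge0// ltW|exact: VW].
Qed.

(** For [a] in [H], orthogonality of [f V - g V] to [a] turns the average of [re a] over [V] into
    the integral of [re a * re (g V) + im a * im (g V)]. The averages tend to [re (a x0)], the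
    integrals to the left-hand side. Membership in [M_0] holds because each [g V] is in [H]. *)
Lemma limit_charge : exists p1 q1 p2 q2 : {finite_measure set (Borel X) -> \bar R},
  [/\ cregular (diff_charge p1 q1) (diff_charge p2 q2),
      in_M0 mu H (diff_charge p1 q1) (diff_charge p2 q2) &
      forall a, H a -> ccontinuous a ->
        (\int[p1]_(x in [set: Borel X]) re (a x) - \int[q1]_(x in [set: Borel X]) re (a x)) +
        (\int[p2]_(x in [set: Borel X]) im (a x) - \int[q2]_(x in [set: Borel X]) im (a x))
        = re (a x0)].
Proof.
have [HL _ _ _ _] := hH.
have [g gP] := proj.
have gH V : H (g V) by case: (gP V).
have gm V : cmeasurable (g V) by case: (HL _ (gH V)).
have g1 V : (\int[mu]_(x in [set: Borel X]) (cabs (g V x))%:E <= C%:E)%E.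
  by have := Pi_bounded (f_L2 V) (gP V); rewrite f_L1 mule1.
have mcabs V : measurable_fun setT (fun x : Borel X => cabs (g V x)).
  apply: (measurableT_comp (continuous_measurable_fun (@sqrt_continuous R))).
  have [? ?] := gm V.
  by apply: measurable_funD; exact: measurable_funX.
have icabs V : mu.-integrable setT (EFin \o (fun x : Borel X => cabs (g V x))).
  apply/integrableP; split; first exact/measurable_EFinP.
  apply: le_lt_trans (ltry C); apply: le_trans (g1 V).
  by under eq_integral do rewrite /= ger0_norm ?cabs_ge0//.
have [U [UU shrinkU]] := ultraFilterLemma shrink_proper.
(* [weak_star_limit] takes nonnegative densities, so the positive and negative parts of [re (g V)]
   and [im (g V)] pass to the limit separately; each is at most [|g V|], of integral at most [C]. *)
have part (s : R[i] -> R) : (forall V, measurable_fun setT (fun x : Borel X => s (g V x))) ->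
    (forall z, s z <= cabs z) -> exists p : {finite_measure set (Borel X) -> \bar R},
    regular_measure p /\ forall phi : X -> R, continuous phi ->
      (fun V => \int[mu]_x (phi x * Num.max (s (g V x)) 0)) @ U --> \int[p]_x phi x.
  move=> ms sle.
  apply: (@weak_star_limit _ _ cX hX mu _ U UU (fun V x => Num.max (s (g V x)) 0) C).
  - by move=> V; apply: measurable_maxr => //; exact: measurable_cst.
  - by move=> V x; rewrite le_max lexx orbT.
  move=> V; apply: le_trans (g1 V); apply: ge0_le_integral => //.
  - by move=> x _; rewrite lee_fin le_max lexx orbT.
  - by apply/measurable_EFinP; apply: measurable_maxr => //; exact: measurable_cst.
  - exact/measurable_EFinP.
  - by move=> x _; rewrite lee_fin ge_max sle cabs_ge0.
have signed (s : R[i] -> R) : (forall V, measurable_fun setT (fun x : Borel X => s (g V x))) ->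
    (forall z, `|s z| <= cabs z) ->
    exists p q : {finite_measure set (Borel X) -> \bar R},
    [/\ regular_measure p, regular_measure q & forall phi : X -> R, continuous phi ->
      (fun V => \int[mu]_x (phi x * s (g V x))) @ U --> \int[p]_x phi x - \int[q]_x phi x].
  move=> ms sle.
  have [p [rp pl]] := part s ms (fun z => le_trans (ler_norm _) (sle z)).
  have msN V : measurable_fun setT (fun x : Borel X => - s (g V x)).
    exact: measurableT_comp (ms V).
  have [q [rq ql]] := part (fun z => - s z) msN
    (fun z => le_trans (ler_norm _) (eq_ind_r (fun y => y <= _) (sle z) (normrN _))).
  exists p, q; split => // phi cphi.
  have [B B0 phiB] := compact_continuous_bounded cX cphi.
  have imax (t : R[i] -> R) V : (forall V, measurable_fun setT (fun x : Borel X => t (g V x))) ->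
      (forall z, t z <= cabs z) ->
      mu.-integrable setT (EFin \o (fun x : Borel X => phi x * Num.max (t (g V x)) 0)).
    move=> mt tle; apply: (integrableM_bounded (continuous_Borel cphi) phiB).
    apply: (le_integrable measurableT _ _ (icabs V)).
      by apply/measurable_EFinP; apply: measurable_maxr => //; exact: measurable_cst.
    move=> x _ /=; rewrite lee_fin (ger0_norm (cabs_ge0 _)) ger0_norm.
      by rewrite ge_max tle cabs_ge0.
    by rewrite le_max lexx orbT.
  have -> : (fun V => \int[mu]_x (phi x * s (g V x))) =
     (fun V => \int[mu]_x (phi x * Num.max (s (g V x)) 0) -
               \int[mu]_x (phi x * Num.max (- s (g V x)) 0)).
    apply/funext => V; rewrite -RintegralB//; first last.
    - exact: (imax (fun z => - s z) V msN
        (fun z => le_trans (ler_norm _) (eq_ind_r (fun y => y <= _) (sle z) (normrN _)))).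
    - exact: (imax s V ms (fun z => le_trans (ler_norm _) (sle z))).
    apply: eq_Rintegral => x _; rewrite -mulrBr; congr (_ * _).
    by rewrite /Num.max; case: ifPn; case: ifPn; rewrite -?leNgt => ? ?; lra.
  by apply: cvgB; [exact: pl|exact: ql].
have mre V : measurable_fun setT (fun x : Borel X => re (g V x)) by case: (gm V).
have mim V : measurable_fun setT (fun x : Borel X => im (g V x)) by case: (gm V).
have [p1 [q1 [rp1 rq1 L1]]] := signed (@complex.Re R) mre re_le_cabs.
have [p2 [q2 [rp2 rq2 L2]]] := signed (@complex.Im R) mim im_le_cabs.
have ipart (s : R[i] -> R) (phi : X -> R) V :
    (forall V, measurable_fun setT (fun x : Borel X => s (g V x))) ->
    (forall z, `|s z| <= cabs z) -> continuous phi ->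
    mu.-integrable setT (EFin \o (fun x : Borel X => phi x * s (g V x))).
  move=> ms sle cphi; have [B B0 phiB] := compact_continuous_bounded cX cphi.
  apply: (integrableM_bounded (continuous_Borel cphi) phiB).
  apply: (le_integrable measurableT _ _ (icabs V)); first exact/measurable_EFinP.
  by move=> x _ /=; rewrite lee_fin (ger0_norm (cabs_ge0 _)).
have ire phi V := @ipart (@complex.Re R) phi V mre re_le_cabs.
have iim phi V := @ipart (@complex.Im R) phi V mim im_le_cabs.
exists p1, q1, p2, q2; split.
- exact: cregular_diff_charge.
- move=> n phi cphi e e0.
  (* The integral of [phi k] against the limit measure. [cmeas_int] accepts any decomposition, so
     [p1], [q1] and [p2], [q2] need not be mutually singular. *)
  pose z k : R[i] := (cint p1 (phi k) - cint q1 (phi k)) +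
    Complex 0 1 * (cint p2 (phi k) - cint q2 (phi k)).
  have near_z k : (k < n)%N -> U [set V | cabs (cint mu (fun x => phi k x * g V x) - z k) < e].
    move=> /cphi[cr ci]; have e2 : 0 < e / 2 by rewrite divr_gt0.
    have nr : (fun V => \int[mu]_x (re (phi k x) * re (g V x)) -
        \int[mu]_x (im (phi k x) * im (g V x))) @ U -->
        \int[p1]_x re (phi k x) - \int[q1]_x re (phi k x) -
        (\int[p2]_x im (phi k x) - \int[q2]_x im (phi k x)).
      exact: cvgB (L1 _ cr) (L2 _ ci).
    have ni : (fun V => \int[mu]_x (re (phi k x) * im (g V x)) +
        \int[mu]_x (im (phi k x) * re (g V x))) @ U -->
        \int[p2]_x re (phi k x) - \int[q2]_x re (phi k x) +
        (\int[p1]_x im (phi k x) - \int[q1]_x im (phi k x)).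
      exact: cvgD (L2 _ cr) (L1 _ ci).
    move/cvgrPdist_lt : nr => /(_ _ e2) nr; move/cvgrPdist_lt : ni => /(_ _ e2) ni.
    apply: filterS2 nr ni => V; rewrite /= => nr ni.
    set zz := _ - z k.
    apply: le_lt_trans (cabs_le_parts _) _; rewrite (splitr e); apply: ltrD.
      rewrite distrC in nr; apply: le_lt_trans nr; rewrite le_eqVlt; apply/orP; left; apply/eqP.
      congr `|_|; rewrite /zz /z !cE /=.
      have -> : fine (\int[mu]_(x in [set: Borel X]) (re (phi k x * g V x))%:E) =
          \int[mu]_x (re (phi k x) * re (g V x)) - \int[mu]_x (im (phi k x) * im (g V x)).
        rewrite -RintegralB//; [|exact: ire|exact: iim].
        by apply: eq_Rintegral => x _; rewrite !cE.
      rewrite /Rintegral; ring.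
    rewrite distrC in ni; apply: le_lt_trans ni; rewrite le_eqVlt; apply/orP; left; apply/eqP.
    congr `|_|; rewrite /zz /z !cE /=.
    have -> : fine (\int[mu]_(x in [set: Borel X]) (im (phi k x * g V x))%:E) =
        \int[mu]_x (re (phi k x) * im (g V x)) + \int[mu]_x (im (phi k x) * re (g V x)).
      rewrite -RintegralD//; [|exact: iim|exact: ire].
      by apply: eq_Rintegral => x _; rewrite !cE.
    rewrite /Rintegral; ring.
  have [V hV] := filter_ex (filter_forall_ltn _ near_z).
  exists (g V) => // k kn; exists (z k); split; last exact: hV.
  by exists p1, q1, p2, q2; split => // E mE; rewrite diff_chargeE.
- move=> a Ha [cr ci].
  have lhs : (fun V => \int[mu]_x (re (a x) * w V x)) @ U --> re (a x0).
    by apply: cvg_trans (average_cvg cr) => B /shrinkU.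
  have rhs : (fun V => \int[mu]_x (re (a x) * re (g V x)) +
      \int[mu]_x (im (a x) * im (g V x))) @ U -->
      \int[p1]_x re (a x) - \int[q1]_x re (a x) +
      (\int[p2]_x im (a x) - \int[q2]_x im (a x)).
    exact: cvgD (L1 _ cr) (L2 _ ci).
  suff E : (fun V => \int[mu]_x (re (a x) * w V x)) =
     (fun V => \int[mu]_x (re (a x) * re (g V x)) + \int[mu]_x (im (a x) * im (g V x))).
    by rewrite E in lhs; exact: (cvg_unique (@Rhausdorff R) rhs lhs).
  apply/funext => V; have [_ /(_ a Ha)] := gP V.
  rewrite inner_dotL2 => /(congr1 (@complex.Re R)) /= h0.
  have [B B0 aB] := compact_continuous_bounded cX cr.
  have iw := integrableM_bounded (continuous_Borel cr) aB (w_int V).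
  have i1 := ire _ V cr; have i2 := iim _ V ci.
  apply/eqP; rewrite -subr_eq0 -RintegralD//.
  rewrite -RintegralB//; last exact: (integrableD measurableT i1 i2).
  rewrite -[X in _ == X]h0; apply/eqP; apply: eq_Rintegral => x _.
  by rewrite /dotc !cE /=; ring.
Qed.

End LimitCharge.

(** * Evaluation at the peak point *)

Section Evaluation.
Context {R : realType} {X : ptopologicalType}.
Variables p1 q1 p2 q2 : {finite_measure set (Borel X) -> \bar R}.
Variable x0 : X.

(* With [nu = (p1 - q1) + i (p2 - q2)], the equation is the real part of
   [\int conj b dnu = conj (b x0)]. *)
Definition evaluates (b : X -> R[i]) : Prop := cmeasurable b /\
  (\int[p1]_(x in [set: Borel X]) re (b x) - \int[q1]_(x in [set: Borel X]) re (b x)) +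
  (\int[p2]_(x in [set: Borel X]) im (b x) - \int[q2]_(x in [set: Borel X]) im (b x))
  = re (b x0).

(** Dominated convergence for the four finite measures. Bounded pointwise convergence is needed, not
    just uniform: the peaking functions tend to a multiple of an indicator. *)
Lemma evaluates_lim (b_ : nat -> X -> R[i]) (b : X -> R[i]) (M : R) :
  (forall n, evaluates (b_ n)) -> (forall n x, cabs (b_ n x) <= M) ->
  (forall x, (fun n => cabs (b x - b_ n x)) @ \oo --> (0 : R)) -> evaluates b.
Proof.
move=> eb bM bb.
have part_cvg (s : R[i] -> R) x : (forall z, `|s z| <= cabs z) ->
    (forall z w, s (z - w) = s z - s w) -> (fun n => s (b_ n x)) @ \oo --> s (b x).
  move=> sle sB; apply/cvgrPdist_le => e e0.
  have := bb x; move/cvgrPdist_le => /(_ e e0); apply: filterS => n.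
  by rewrite sub0r normrN ger0_norm ?cabs_ge0// -sB; apply: le_trans.
have reB (z w : R[i]) : re (z - w) = re z - re w by rewrite !cE.
have imB (z w : R[i]) : im (z - w) = im z - im w by rewrite !cE.
have cr x := part_cvg (@complex.Re R) x re_le_cabs reB.
have ci x := part_cvg (@complex.Im R) x im_le_cabs imB.
have mr n : measurable_fun [set: Borel X] (fun x : Borel X => re (b_ n x)) by case: (eb n) => -[].
have mi n : measurable_fun [set: Borel X] (fun x : Borel X => im (b_ n x)) by case: (eb n) => -[].
have rM n x : `|re (b_ n x)| <= M by apply: le_trans (re_le_cabs _) (bM n x).
have iM n x : `|im (b_ n x)| <= M by apply: le_trans (im_le_cabs _) (bM n x).
have [mbr lp1] := bounded_convergence p1 mr rM cr.
have [_ lq1] := bounded_convergence q1 mr rM cr.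
have [mbi lp2] := bounded_convergence p2 mi iM ci.
have [_ lq2] := bounded_convergence q2 mi iM ci.
split; first by split.
have lim : (fun n => \int[p1]_x re (b_ n x) - \int[q1]_x re (b_ n x) +
    (\int[p2]_x im (b_ n x) - \int[q2]_x im (b_ n x))) @ \oo -->
    \int[p1]_x re (b x) - \int[q1]_x re (b x) + (\int[p2]_x im (b x) - \int[q2]_x im (b x)).
  exact: cvgD (cvgB lp1 lq1) (cvgB lp2 lq2).
have E : (fun n => \int[p1]_x re (b_ n x) - \int[q1]_x re (b_ n x) +
    (\int[p2]_x im (b_ n x) - \int[q2]_x im (b_ n x))) = (fun n => re (b_ n x0)).
  by apply/funext => n; case: (eb n).
by rewrite E in lim; exact: (cvg_unique (@Rhausdorff R) lim (cr x0)).
Qed.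

Lemma uclosure_evaluates (A : set (X -> R[i])) (b : X -> R[i]) (M : R) :
  (forall a, A a -> evaluates a) -> (forall x, cabs (b x) <= M) ->
  uclosure A b -> evaluates b.
Proof.
move=> eA bM ub.
have /choice[a aP] : forall n, exists a, A a /\ forall x, cabs (b x - a x) < n.+1%:R^-1.
  by move=> n; have [|a Aa ba] := ub n.+1%:R^-1; [rewrite invr_gt0|exists a].
have ba n x : cabs (b x - a n x) < n.+1%:R^-1 by case: (aP n).
apply: (@evaluates_lim a b (M + 1)) => [n|n x|x].
- by apply: eA; case: (aP n).
- rewrite -[a n x](subrK (b x)) addrC; apply: le_trans (cabsD _ _) _.
  rewrite lerD// cabsB; apply: le_trans (ltW (ba n x)) _.
  by rewrite invf_le1// ler1n.
- apply: (squeeze_cvgr _ (cvg_cst 0) (@cvg_harmonic R)).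
  by apply: nearW => n; rewrite cabs_ge0/= ltW.
Qed.

(** The limit of [c n] is half the indicator of [E], a real function, so the identity at the limit
    reads [(p1 E - q1 E) / 2 = 1 / 2]. *)
Lemma not_evaluates_null_peak (c : nat -> X -> R[i]) (E : set (Borel X)) (M : R) :
  measurable E -> p1 E = q1 E -> E x0 ->
  (forall n, evaluates (c n)) -> (forall n x, cabs (c n x) <= M) ->
  (forall n x, E x -> c n x = Complex 2^-1 0) ->
  (forall x, ~ E x -> (fun n => cabs (c n x)) @ \oo --> (0 : R)) -> False.
Proof.
move=> mE pqE Ex0 ec cM cE0 cnE.
pose b (x : X) : R[i] := Complex (2^-1 * \1_E x) 0.
have [_] : evaluates b.
  apply: (evaluates_lim ec cM) => x; have [Ex|nEx] := pselect (E x).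
    have -> : (fun n => cabs (b x - c n x)) = (fun=> 0).
      apply/funext => n; apply/eqP; rewrite cabs0_eq0 cE0// /b indicE mem_set//.
      by rewrite mulr1 subrr.
    exact: cvg_cst.
  have -> : (fun n => cabs (b x - c n x)) = (fun n => cabs (c n x)).
    apply/funext => n; rewrite cabsB; congr cabs; rewrite /b indicE memNset//.
    by rewrite mulr0 -[Complex 0 0]/(0 : R[i]) subr0.
  exact: cnE.
have intE (p : {finite_measure set (Borel X) -> \bar R}) :
    \int[p]_(x in [set: Borel X]) re (b x) = 2^-1 * fine (p E).
  rewrite /b /= RintegralZl//.
    by rewrite /Rintegral integral_indic// setIT.
  apply: (@bounded_integrable _ _ _ _ _ 1) => // x.
  by rewrite indicE; case: (_ \in _); rewrite ?normr1 ?normr0.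
rewrite !intE pqE subrr !Rintegral_cst// !mul0r subrr addr0 /b /= indicE mem_set// mulr1.
by move/eqP; rewrite eq_sym invr_eq0 pnatr_eq0.
Qed.

End Evaluation.

Unset Implicit Arguments.
Set Strict Implicit.

Theorem theorem3p1 (R : realType) (X : ptopologicalType)
  (hcompact : compact [set: X]) (hconn : connected [set: X])
  (hhaus : hausdorff_space X)
  (mu : {finite_measure set Borel X -> \bar R})
  (mu_reg : regular_measure mu) (mu_supp : full_support mu)
  (H : set (X -> R[i])) (hH : closed_L2_subspace mu H)
  (A : set (X -> R[i])) (hA : subalgebra_in H A)
  (hi : exists2 f0, A f0 & exists x y, f0 x != f0 y)
  (hii : forall nur nui : {charge set Borel X -> \bar R},
     cregular nur nui -> in_M0 mu H nur nui -> cabs_cont mu nur nui) :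
  ~ exists C : R, forall f g : X -> R[i],
      L2 mu f -> is_orth_proj mu H f g ->
      (L1norm mu g <= C%:E * L1norm mu f)%E.
Proof.
move=> [C PiC]; have [AcH Acst AD _ AM] := hA.
have Ac f : A f -> ccontinuous f by case/AcH.
have Abd f : A f -> exists K, forall x, cabs (f x) <= K.
  move=> /Ac[cr ci].
  have [Kr _ hr] := compact_continuous_bounded hcompact cr.
  have [Ki _ hj] := compact_continuous_bounded hcompact ci.
  by exists (Kr + Ki) => x; apply: le_trans (cabs_le_parts _) _; exact: lerD.
have [u [x0 [Au ux0 u4 uslit null]]] :=
  exists_peak_point mu hcompact hconn Ac Acst AD AM hi.
have [p1 [q1 [p2 [q2 [reg inM0 eval]]]]] :=
  limit_charge hcompact hhaus mu_supp hH PiC x0.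
have [/null_content_dominatesP dom _] := hii _ _ reg inM0.
have mE : measurable ([set x | u x = 0] : set (Borel X)).
  by apply: closed_Borel; apply: closed_zeros; exact: Ac.
(* Absolute continuity concerns the charge [p1 - q1]: it yields equality of the two masses, not that
   each vanishes. *)
have pqE : p1 [set x | u x = 0] = q1 [set x | u x = 0].
  have := dom _ mE null; rewrite diff_chargeE => pq0.
  have qfin : q1 [set x | u x = 0] \is a fin_num by exact: fin_num_measure.
  by rewrite -[LHS](subeK _ qfin) pq0 add0e.
have evalA a : A a -> evaluates p1 q1 p2 q2 x0 a.
  move=> /AcH[ca Ha]; split; last exact: eval.
  by case: ca => cr ci; split; exact: continuous_Borel.
have [c [uc c1 c2 c0]] := peaking_sequence hcompact Acst AD AM Abd Au (Ac _ Au) u4 uslit.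
apply: (@not_evaluates_null_peak _ _ p1 q1 p2 q2 x0 c _ 2 mE pqE ux0) => //.
by move=> n; exact: (uclosure_evaluates evalA (c2 n) (uc n)).
Qed.
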